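(* Let $\Bbbk$ be algebraically closed of characteristic not $2$, and let $X,Y\subset\mathbb{A}^n$ be nonempty varieties that are disjoint at infinity. Then $\dim(X+Y)=\dim X+\dim Y$.
   Context: The Minkowski sum $X+Y$ is the Zariski closure of $\{p+q\mid p\in X,q\in Y\}$. $X$ and $Y$ are disjoint at infinity if $\overline X\cap\overline Y\cap H_0=\emptyset$, where $\overline X,\overline Y\subset\mathbb{P}^n$ are projective closures and $H_0=\{x_0=0\}$ is the hyperplane at infinity. *)

(* Defs.v *)
From HB Require Import structures.
From mathcomp Require Import all_boot all_order all_algebra.
From mathcomp Require Import mpoly.
From Stdlib Require Import ClassicalEpsilon.

Set Implicit Arguments.
Unset Strict Implicit.
Unset Printing Implicit Defensive.

Import GRing.Theory.
Local Open Scope ring_scope.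

Definition point (k : fieldType) (n : nat) := 'I_n -> k.
Definition aset (k : fieldType) (n : nat) := point k n -> Prop.

Definition zclosure (k : fieldType) (n : nat) (S : aset k n) : aset k n :=
  fun x => forall p : {mpoly k[n]}, (forall y, S y -> p.@[y] = 0) -> p.@[x] = 0.

Definition zclosed (k : fieldType) (n : nat) (S : aset k n) : Prop :=
  forall x, zclosure S x -> S x.

Definition zirreducible (k : fieldType) (n : nat) (S : aset k n) : Prop :=
  zclosed S /\ (exists x, S x) /\
  forall A B : aset k n, zclosed A -> zclosed B ->
    (forall x, S x -> A x \/ B x) ->
    (forall x, S x -> A x) \/ (forall x, S x -> B x).

Definition has_chain (k : fieldType) (n : nat) (S : aset k n) (m : nat) : Prop :=
  exists Z : nat -> aset k n,
    (forall i, (i <= m)%N -> zirreducible (Z i) /\ (forall x, Z i x -> S x)) /\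
    (forall i, (i < m)%N ->
       (forall x, Z i x -> Z i.+1 x) /\ (exists x, Z i.+1 x /\ ~ Z i x)).

(* Dimension = maximal length of a chain of irreducible closed subsets
   (Krull dimension of the Zariski topology on S).  Chosen classically;
   for nonempty affine algebraic sets this maximum exists. *)
Definition zdim (k : fieldType) (n : nat) (S : aset k n) : nat :=
  epsilon (inhabits 0%N)
    (fun d => has_chain S d /\ forall m, has_chain S m -> (m <= d)%N).

Definition minkowski_sum (k : fieldType) (n : nat) (X Y : aset k n) : aset k n :=
  zclosure (fun z => exists x y, X x /\ Y y /\ z = (fun i => x i + y i)).

Definition homog_pt (k : fieldType) (n : nat) (x : point k n) : point k n.+1 :=
  fun i => if unlift ord0 i is Some j then x j else 1.

(* Affine cone over the projective closure of S in P^n: a nonzero vector v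
   of k^{n+1} represents a point [v] of the projective closure iff every
   homogeneous polynomial in x_0..x_n vanishing on {[1:x] | x in S}
   vanishes at v. *)
Definition proj_closure_cone (k : fieldType) (n : nat) (S : aset k n)
    : point k n.+1 -> Prop :=
  fun v => forall (d : nat) (F : {mpoly k[n.+1]}), F \is d.-homog ->
    (forall x, S x -> F.@[homog_pt x] = 0) -> F.@[v] = 0.

Definition disjoint_at_infinity (k : fieldType) (n : nat) (X Y : aset k n) : Prop :=
  ~ exists v : point k n.+1,
      v ord0 = 0 /\ (exists i, v i != 0) /\
      proj_closure_cone X v /\ proj_closure_cone Y v.

(* Main.v *)
Require Import Defs.
From HB Require Import structures.
From mathcomp Require Import all_boot all_order all_algebra.
From mathcomp Require Import mpoly ring zify.
From Stdlib Require Import Classical ClassicalEpsilon.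

(** Disjointness at infinity makes the addition map [X x Y -> X + Y] finite: by the
    Nullstellensatz some power of every coordinate [x_i] is the sum of a leading form
    of an equation of [X] and a leading form of an equation of [Y], and substituting
    [y = z - x] in the latter gives an equation of integrality of the [x_i] over the
    coordinate ring of [X + Y].  Composing with Noether normalizations of [X + Y], [X]
    and [Y], the coordinate ring of [X x Y] is a finite module over two polynomial
    subrings, of dimensions [dim (X + Y)] and [dim X + dim Y]; counting monomials, any
    algebraically independent family is at most as long as the number of variables of
    such a subring, so both numbers agree.  The Krull dimension of a closed set is
    compared with the number of variables of a normalization in the same way: a strict
    chain of irreducible closed sets yields an algebraically independent family, and
    conversely finite maps are closed, so that a flag of linear subspaces lifts to a
    chain. *)

Set Implicit Arguments.
Unset Strict Implicit.
Unset Printing Implicit Defensive.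

Import Order.TTheory GRing.Theory.
Local Open Scope ring_scope.

(** * Ideals and finite extensions *)

(** [msub f] is composition with the polynomial map whose components are [f]. *)
Local Notation msub f := (mmap (@mpolyC _ _) f).

Section Substitution.
Variables (k : fieldType) (d N : nat).
Implicit Types (f : 'I_d -> {mpoly k[N]}).

Lemma msubC f c : msub f c%:MP = c%:MP.
Proof. exact: mmapC. Qed.

Lemma msubX f i : msub f 'X_i = f i.
Proof. by rewrite mmapX mmap1U. Qed.

Lemma meval_msub f P x : (msub f P).@[x] = P.@[fun i => (f i).@[x]].
Proof.
rewrite /mmap rmorph_sum /=; apply: eq_bigr => m _.
rewrite rmorphM /= mevalC /mmap1 rmorph_prod /=.
by congr (_ * _); apply: eq_bigr => i _; rewrite rmorphXn.
Qed.

End Substitution.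

Lemma msub_id (k : fieldType) N (p : {mpoly k[N]}) : msub (fun i => 'X_i) p = p.
Proof.
rewrite [in RHS](mpolyE p) /mmap; apply: eq_bigr => m _.
by rewrite mul_mpolyC mmap1_id.
Qed.

Lemma msub_comp (k : fieldType) c d N (f : 'I_d -> {mpoly k[N]})
    (g : 'I_c -> {mpoly k[d]}) P :
  msub f (msub g P) = msub (fun i => msub f (g i)) P.
Proof.
rewrite [X in msub f X]/mmap rmorph_sum /=; apply: eq_bigr => m _.
rewrite rmorphM /= msubC /mmap1 rmorph_prod /=.
by congr (_ * _); apply: eq_bigr => i _; rewrite rmorphXn.
Qed.

Record is_ideal (A : comNzRingType) (J : A -> Prop) : Prop := IsIdeal {
  idl0 : J 0;
  idlD : forall p q, J p -> J q -> J (p + q);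
  idlMl : forall r p, J p -> J (r * p) }.

Section IdealTheory.
Variables (A : comNzRingType) (J : A -> Prop).
Hypothesis idJ : is_ideal J.

Lemma idlMr r p : J p -> J (p * r).
Proof. by rewrite mulrC; apply: idlMl. Qed.

Lemma idlN p : J p -> J (- p).
Proof. by rewrite -mulN1r; apply: idlMl. Qed.

Lemma idlB p q : J p -> J q -> J (p - q).
Proof. by move=> Jp Jq; apply: idlD => //; apply: idlN. Qed.

Lemma idl_sum (I : Type) (r : seq I) (P : pred I) (F : I -> A) :
  (forall i, P i -> J (F i)) -> J (\sum_(i <- r | P i) F i).
Proof. by move=> JF; elim/big_ind: _ => //; [apply: idl0 | apply: idlD]. Qed.

Lemma idl_congr p q : J (p - q) -> J q -> J p.
Proof. by move=> Jpq Jq; rewrite -(subrK q p); apply: idlD. Qed.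

Lemma idl_adjoin (I : finType) (g : I -> A) :
  is_ideal (fun p => exists r : I -> A, J (p - \sum_i r i * g i)).
Proof.
split=> [|p q [r Jp] [s Jq]|r p [s Jp]].
- exists (fun=> 0); rewrite big1 ?subrr; first exact: idl0.
  by move=> i _; rewrite mul0r.
- exists (fun i => r i + s i).
  under eq_bigr do rewrite mulrDl.
  by rewrite big_split /= opprD addrACA; apply: idlD.
- exists (fun i => r * s i).
  under eq_bigr do rewrite -mulrA.
  by rewrite -mulr_sumr -mulrBr; apply: idlMl.
Qed.

End IdealTheory.

Section Span.
Variables (k : fieldType) (N : nat) (J : {mpoly k[N]} -> Prop).
Hypothesis idJ : is_ideal J.

Definition modspan d (f : 'I_d -> {mpoly k[N]}) (I : finType) (B : I -> {mpoly k[N]})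
    (p : {mpoly k[N]}) : Prop :=
  exists c : I -> {mpoly k[d]}, J (p - \sum_i msub f (c i) * B i).

(** The generators [B] may be arbitrary polynomials: [k[g]] need only sit, modulo [J], inside a
    finitely generated [k[f]]-module. *)
Definition finite_over d (f : 'I_d -> {mpoly k[N]}) m (g : 'I_m -> {mpoly k[N]}) :=
  exists (I : finType) (B : I -> {mpoly k[N]}), forall P, modspan f B (msub g P).

Definition alg_indep d (f : 'I_d -> {mpoly k[N]}) : Prop :=
  forall P, J (msub f P) -> P = 0.

Section FixedFamily.
Variables (d : nat) (f : 'I_d -> {mpoly k[N]}) (I : finType) (B : I -> {mpoly k[N]}).

Lemma modspan_congr p q : J (p - q) -> modspan f B q -> modspan f B p.
Proof.
move=> Jpq [c Jq]; exists c.
by have -> : p - \sum_i msub f (c i) * B i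
  = (p - q) + (q - \sum_i msub f (c i) * B i); [ring | apply: idlD].
Qed.

Lemma modspan0 : modspan f B 0.
Proof.
exists (fun=> 0); rewrite big1 ?subrr; first exact: idl0.
by move=> i _; rewrite rmorph0 mul0r.
Qed.

Lemma modspanD p q : modspan f B p -> modspan f B q -> modspan f B (p + q).
Proof.
move=> [b Jp] [c Jq]; exists (fun i => b i + c i).
under eq_bigr do rewrite rmorphD mulrDl.
by rewrite big_split /= opprD addrACA; apply: idlD.
Qed.

Lemma modspanM w p : modspan f B p -> modspan f B (msub f w * p).
Proof.
move=> [c Jp]; exists (fun i => w * c i).
under eq_bigr do rewrite rmorphM -mulrA.
by rewrite -mulr_sumr -mulrBr; apply: idlMl.
Qed.

Lemma modspanZ a p : modspan f B p -> modspan f B (a%:MP * p).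
Proof. by rewrite -(msubC f); apply: modspanM. Qed.

Lemma modspanN p : modspan f B p -> modspan f B (- p).
Proof. by move/(modspanZ (-1)); rewrite mpolyCN mulN1r. Qed.

Lemma modspan_gen i : modspan f B (B i).
Proof.
exists (fun j => (j == i)%:R).
rewrite (bigD1 i) //= eqxx rmorph1 mul1r big1 ?addr0 ?subrr; first exact: idl0.
by move=> j /negPf ->; rewrite rmorph0 mul0r.
Qed.

Lemma modspan_sum (T : Type) (r : seq T) (P : pred T) (F : T -> {mpoly k[N]}) :
  (forall i, P i -> modspan f B (F i)) -> modspan f B (\sum_(i <- r | P i) F i).
Proof. by move=> BF; elim/big_ind: _ => //; [apply: modspan0 | apply: modspanD]. Qed.

End FixedFamily.

Lemma modspan_subM d (f : 'I_d -> {mpoly k[N]}) (I I' : finType)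
    (B : I -> {mpoly k[N]}) (B' : I' -> {mpoly k[N]}) u p :
  (forall i, modspan f B' (u * B i)) -> modspan f B p -> modspan f B' (u * p).
Proof.
move=> uB [c Jp]; apply: (modspan_congr (q := u * \sum_i msub f (c i) * B i)).
  by rewrite -mulrBr; apply: idlMl.
by rewrite mulr_sumr; apply: modspan_sum => i _; rewrite mulrCA; apply: modspanM.
Qed.

Lemma modspan_sub d (f : 'I_d -> {mpoly k[N]}) (I I' : finType)
    (B : I -> {mpoly k[N]}) (B' : I' -> {mpoly k[N]}) p :
  (forall i, modspan f B' (B i)) -> modspan f B p -> modspan f B' p.
Proof.
by move=> BB'; rewrite -[X in modspan _ B' X](mul1r p); apply: modspan_subM => i; rewrite mul1r.
Qed.

(** Starting from [1], monomials in [g] are built one factor at a time without leaving the span. *)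
Lemma modspan_subalgebra d (f : 'I_d -> {mpoly k[N]}) (I : finType)
    (B : I -> {mpoly k[N]}) m (g : 'I_m -> {mpoly k[N]}) :
  modspan f B 1 -> (forall i j, modspan f B (g i * B j)) ->
  forall P, modspan f B (msub g P).
Proof.
move=> B1 gB P; rewrite /mmap; apply: modspan_sum => u _; apply: modspanZ.
rewrite /mmap1; elim/big_rec: _ => // i p _ Bp.
elim: (u i) => [|e IH]; first by rewrite expr0 mul1r.
by rewrite exprS -mulrA; apply: modspan_subM IH => j; apply: gB.
Qed.

Lemma modspan_pair d (f : 'I_d -> {mpoly k[N]}) (I I' : finType)
    (B : I -> {mpoly k[N]}) (B' : I' -> {mpoly k[N]}) p q :
  modspan f B p -> modspan f B' q -> modspan f (fun ij => B ij.1 * B' ij.2) (p * q).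
Proof.
move=> Bp Bq; apply: modspan_subM Bq => j; rewrite mulrC.
by apply: modspan_subM Bp => i; rewrite mulrC; apply: (modspan_gen _ _ (i, j)).
Qed.

Lemma finite_over_trans d (f : 'I_d -> {mpoly k[N]}) e (g : 'I_e -> {mpoly k[N]})
    m (h : 'I_m -> {mpoly k[N]}) :
  finite_over f g -> finite_over g h -> finite_over f h.
Proof.
move=> [I [B fB]] [I' [B' gB']].
exists (I * I')%type, (fun ij => B ij.1 * B' ij.2) => P.
have [c Jc] := gB' P; apply: modspan_congr Jc _; apply: modspan_sum => j _.
by apply: modspan_pair => //; apply: modspan_gen.
Qed.

End Span.

(** * Counting monomials *)

Section LastVariable.
Variables (k : fieldType) (n : nat).

Notation widen := (widen_ord (leqnSn n)).

Lemma mmap_muni (A : comNzRingType) (phi : {rmorphism k -> A})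
    (h : 'I_n.+1 -> A) p :
  mmap phi h p = (map_poly (mmap phi (h \o widen)) (muni p)).[h ord_max].
Proof.
rewrite muniE rmorph_sum /= horner_sum; apply: eq_bigr => m _.
rewrite map_polyZ map_polyXn /= hornerZ hornerXn mmapZ mmapX -mulrA.
congr (_ * _); rewrite /mmap1 big_ord_recr /=.
by congr (_ * _); apply: eq_bigr => i _; rewrite mnmE.
Qed.

Lemma muni_eq0 (p : {mpoly k[n.+1]}) : muni p = 0 -> p = 0.
Proof. by move=> p0; rewrite -[p]msub_id mmap_muni p0 rmorph0 horner0. Qed.

End LastVariable.

Definition alg_closed (k : fieldType) : Prop :=
  forall p : {poly k}, size p != 1%N -> exists x, root p x.

(** Induction on the number of variables: a point where the leading coefficient in the last variable
    survives is completed by a nonroot of the resulting univariate polynomial. *)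
Lemma mpoly_nonroot (k : fieldType) n (p : {mpoly k[n]}) :
  alg_closed k -> p != 0 -> exists x, p.@[x] != 0.
Proof.
move=> closed_k; elim: n p => [|n IH] p nz_p.
  exists (fun=> 0); rewrite (nvar0_mpolyC p) mevalC.
  by apply: contra_neq nz_p => p0; rewrite (nvar0_mpolyC p) p0 mpolyC0.
have nz_u : muni p != 0 by apply: contra_neq nz_p; apply: muni_eq0.
have [x x_nz] : exists x, (lead_coef (muni p)).@[x] != 0.
  by apply: IH; rewrite lead_coef_eq0.
pose q := map_poly (meval x) (muni p).
have nz_q : q != 0.
  apply: contra_neq x_nz => q0.
  by rewrite lead_coefE -(coef_map (meval x) (muni p)) -/q q0 coef0.
have [b qb] : exists b, q.[b] != 0.
  case: (eqVneq (size q) 1%N) => [/eqP/size_poly1P[c nz_c ->]|sz_q].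
    by exists 0; rewrite hornerC.
  have szq1 : (1 < size q)%N by rewrite ltn_neqAle eq_sym sz_q size_poly_gt0.
  (* As [q] is not constant, [q - 1] has a root, and there [q] takes the value [1]. *)
  have /closed_k[b] : size (q - 1) != 1%N.
    by rewrite size_polyDl ?size_polyN ?size_poly1.
  by rewrite rootE !hornerE subr_eq0 => /eqP qb1; exists b; rewrite qb1 oner_eq0.
exists (fun i => if unlift ord_max i is Some j then x j else b).
rewrite /meval mmap_muni unlift_none.
suff -> : map_poly (mmap idfun ((fun i => if unlift ord_max i is Some j then x j else b)
    \o widen_ord (leqnSn n))) (muni p) = q by [].
apply: eq_map_poly => r; apply: meval_eq => i /=.
have -> : widen_ord (leqnSn n) i = lift ord_max i by apply: val_inj; rewrite [RHS]lift_max.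
by rewrite liftK.
Qed.

Lemma mpoly_vanish (k : fieldType) n (p : {mpoly k[n]}) :
  alg_closed k -> (forall x, p.@[x] = 0) -> p = 0.
Proof.
by move=> closed_k p0; apply/eqP/negPn/negP => /(mpoly_nonroot closed_k)[x]; rewrite p0 eqxx.
Qed.

Lemma mnm_ind n (P : 'X_{1..n} -> Prop) :
  P 0%MM -> (forall i m, P m -> P (U_(i) + m)%MM) -> forall m, P m.
Proof.
move=> P0 PU m; rewrite (multinomUE_id m); elim/big_rec: _ => // i u _ Pu.
elim: (m i) => [|e IH]; first by rewrite mulm0n add0m.
by rewrite mulmS -addmA; apply: PU.
Qed.

Lemma mmap1S (A : comNzRingType) n (h : 'I_n -> A) i m :
  mmap1 h (U_(i) + m) = h i * mmap1 h m.
Proof. by rewrite commr_mmap1_M ?mmap1U // => j x; apply: mulrC. Qed.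

Lemma kernel_nonzero (k : fieldType) (I K : finType) (A : I -> K -> k) :
  (#|K| < #|I|)%N ->
  exists v : I -> k, (exists i, v i != 0) /\ forall j, \sum_i v i * A i j = 0.
Proof.
move=> ltKI; pose M := \matrix_(i < #|I|, j < #|K|) A (enum_val i) (enum_val j).
have /rowV0Pn[v /sub_kermxP vM nz_v] : kermx M != 0.
  rewrite kermx_eq0 -row_leq_rank -ltnNge.
  exact: leq_ltn_trans (rank_leq_col _) ltKI.
exists (fun i => v 0 (enum_rank i)); split.
  by have /rV0Pn[i nz_vi] := nz_v; exists (enum_val i); rewrite enum_valK.
move=> j; have /rowP/(_ (enum_rank j)) := vM; rewrite !mxE => vMj; rewrite -{}[RHS]vMj.
rewrite (reindex_onto (@enum_val I I) enum_rank) => [|i _]; last exact: enum_rankK.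
rewrite (eq_bigl xpredT) => [|i]; last by rewrite enum_valK eqxx.
by apply: eq_bigr => i _; rewrite enum_valK mxE enum_rankK.
Qed.

Lemma card_bmultinom_le n s : (#|{: 'X_{1..n < s}}| <= s ^ n)%N.
Proof.
rewrite -[X in (_ <= X ^ _)%N]card_ord -[X in (_ <= _ ^ X)%N]card_ord -card_ffun.
have lt_s (m : 'X_{1..n < s}) (i : 'I_n) : (bmnm m i < s)%N.
  by apply: leq_ltn_trans (bmdeg m); rewrite mdegE (bigD1 i) //= leq_addr.
apply: (leq_card (fun m => [ffun i => Ordinal (lt_s m i)])) => m1 m2 eqm.
apply: val_inj; apply/mnmP => i.
by have /ffunP/(_ i) := eqm; rewrite !ffunE => /(congr1 val).
Qed.

Section Counting.
Variables (k : fieldType) (N : nat) (J : {mpoly k[N]} -> Prop).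
Hypothesis idJ : is_ideal J.

(** Multiplication by [g i] acts on the generators [B] through a fixed matrix [a] of polynomials in
    [f], so each factor of a monomial raises the degree of the coefficients by a bounded amount. *)
Lemma modspan_degree_bound d (f : 'I_d -> {mpoly k[N]}) (I : finType)
    (B : I -> {mpoly k[N]}) m (g : 'I_m -> {mpoly k[N]}) :
  (forall p, modspan J f B p) ->
  exists c, forall u : 'X_{1..m}, exists w : I -> {mpoly k[d]},
    (forall l, (msize (w l) <= c + c * mdeg u)%N) /\
    J (mmap1 g u - \sum_l msub f (w l) * B l).
Proof.
move=> allB.
have [a Ja] : exists a : 'I_m * I -> I -> {mpoly k[d]},
    forall ij, J (g ij.1 * B ij.2 - \sum_l msub f (a ij l) * B l).
  exact: fin_all_exists (fun ij => allB (g ij.1 * B ij.2)).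
have [e Je] := allB 1.
pose c := (\max_ij \max_l msize (a ij l) + \max_l msize (e l)).+1.
have lt_ac ij l : (msize (a ij l) < c)%N.
  rewrite ltnS; apply: leq_trans (leq_addr _ _).
  apply: leq_trans (leq_bigmax ij).
  exact: (leq_bigmax (F := fun l => msize (a ij l)) l).
have le_ec l : (msize (e l) <= c)%N.
  rewrite leqW //; apply: leq_trans (leq_addl _ _).
  exact: (leq_bigmax (F := fun l => msize (e l)) l).
exists c; elim/mnm_ind => [|i u [w [szw Jw]]].
  exists e; split=> [l|]; first by rewrite mdeg0 muln0 addn0.
  by rewrite mmap11.
exists (fun l => \sum_j w j * a (i, j) l); split=> [l|].
  apply: leq_trans (msize_sum _ _ _) _; apply/bigmax_leqP => j _.
  apply: leq_trans (msizeM_le _ _) _; rewrite mdegD mdeg1.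
  have := lt_ac (i, j) l; have := szw j; lia.
rewrite mmap1S.
have -> : g i * mmap1 g u - \sum_l msub f (\sum_j w j * a (i, j) l) * B l
  = g i * (mmap1 g u - \sum_l msub f (w l) * B l)
  + \sum_j msub f (w j) * (g i * B j - \sum_l msub f (a (i, j) l) * B l).
  rewrite mulrBr -addrA; congr (_ + _).
  rewrite mulr_sumr.
  under [X in _ = _ + X]eq_bigr do rewrite mulrBr.
  rewrite [in RHS]sumrB addrA.
  under eq_bigr do rewrite rmorph_sum mulr_suml.
  rewrite exchange_big /=.
  under [X in _ = _ + X - _]eq_bigr do rewrite mulrCA.
  rewrite addNr add0r; congr (- _); apply: eq_bigr => j _.
  by rewrite mulr_sumr; apply: eq_bigr => l _; rewrite rmorphM mulrA.
apply: idlD => //; first exact: idlMl.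
by apply: (idl_sum idJ) => j _; apply: (idlMl idJ); apply: (Ja (i, j)).
Qed.

(* The [s ^ m] monomials in [g] with exponents below [s] lie in a space whose dimension
   is of order [s ^ d]. *)
Lemma alg_indep_card_le d (f : 'I_d -> {mpoly k[N]}) m (g : 'I_m -> {mpoly k[N]}) :
  finite_over J f (fun i : 'I_N => 'X_i) -> alg_indep J g -> (m <= d)%N.
Proof.
move=> [I [B allB]] indg; rewrite leqNgt; apply/negP => lt_dm.
have {}allB p : modspan J f B p by rewrite -[p]msub_id.
have [c degB] := modspan_degree_bound g allB.
(* [S] bounds the coefficient sizes for monomials with exponents below [s], and [S <= C * s]. The
   choice of [s] gives [#|I| * (C * s) ^ d < s ^ d.+1 <= s ^ m]: fewer linear conditions than
   monomials. *)
pose C := (c + c * m)%N; pose s := (#|I| * C ^ d).+1.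
pose S := (c + c * (m * s))%N.
pose mn (al : {ffun 'I_m -> 'I_s}) : 'X_{1..m} := [multinom val (al i) | i < m].
have [w Hw] : exists w : {ffun 'I_m -> 'I_s} -> I -> {mpoly k[d]}, forall al,
    (forall l, (msize (w al l) <= S)%N) /\
    J (mmap1 g (mn al) - \sum_l msub f (w al l) * B l).
  apply: (@fin_all_exists _ _ (fun al (w : I -> {mpoly k[d]}) =>
    (forall l, (msize (w l) <= S)%N) /\
    J (mmap1 g (mn al) - \sum_l msub f (w l) * B l))) => al; have [w [szw Jw]] := degB (mn al).
  exists w; split=> // l; apply: leq_trans (szw l) _.
  rewrite leq_add2l leq_mul2l mdegE; apply/orP; right.
  have -> : (m * s = \sum_(i < m) s)%N by rewrite sum_nat_const card_ord.
  by apply: leq_sum => i _; rewrite mnmE; exact: ltnW (ltn_ord _).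
pose A al (lb : I * 'X_{1..d < S}) := (w al lb.1)@_(lb.2).
have [|v [[al nz_v] kerA]] := @kernel_nonzero k _ _ A.
  rewrite card_ffun card_prod !card_ord.
  apply: (@leq_ltn_trans (#|I| * (C * s) ^ d)).
    rewrite leq_mul2l; apply/orP; right; apply: leq_trans (card_bmultinom_le _ _) _.
    case: (posnP d) => [->|d_gt0]; first by rewrite !expn0.
    rewrite leq_exp2r // /S /C mulnDl -mulnA leq_add2r.
    by rewrite -[X in (X <= _)%N]muln1 leq_mul2l orbT.
  apply: (@leq_trans (s ^ d.+1)); last exact: leq_pexp2l.
  by rewrite expnMn mulnA expnS ltn_mul2r expn_gt0 /= ltnSn.
case/negP: nz_v; apply/eqP.
(* The kernel vector provides the coefficients of a relation between the [g i]; independence forces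
   them to vanish, against the choice of [al]. *)
pose P := \sum_be v be *: 'X_[mn be].
have mn_inj : injective mn.
  move=> b1 b2 /mnmP eqb; apply/ffunP => i; apply: val_inj.
  by have := eqb i; rewrite !mnmE.
have -> : v al = P@_(mn al).
  rewrite raddf_sum (bigD1 al) //= mcoeffZ mcoeffX eqxx mulr1 big1 ?addr0 // => b ne_b.
  by rewrite mcoeffZ mcoeffX (inj_eq mn_inj) (negPf ne_b) mulr0.
suff -> : P = 0 by rewrite mcoeff0.
apply: indg; rewrite /P rmorph_sum /=.
apply: (idl_congr idJ (q := \sum_be (v be)%:MP * \sum_l msub f (w be l) * B l)).
  rewrite -sumrB; apply: idl_sum => // be _.
  rewrite mmapZ mmapX -mulrBr; apply: idlMl => //; exact: (Hw be).2.
suff -> : \sum_be (v be)%:MP * \sum_l msub f (w be l) * B l = 0 by apply: idl0.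
under eq_bigr do rewrite mulr_sumr.
rewrite exchange_big big1 //= => l _.
under eq_bigr do rewrite mulrA -(msubC f) -rmorphM.
rewrite -mulr_suml -rmorph_sum /=.
suff -> : \sum_be (v be)%:MP * w be l = 0 by rewrite rmorph0 mul0r.
under eq_bigr => be _ do rewrite (mpolywE ((Hw be).1 l)) mulr_sumr.
rewrite exchange_big big1 //= => b _.
under eq_bigr do rewrite mul_mpolyC scalerA.
by rewrite -scaler_suml (kerA (l, b)) scale0r.
Qed.

End Counting.

(** * Fibers of finite maps *)

Section Fiber.
Variables (k : fieldType) (N : nat).
Hypothesis closed_k : alg_closed k.
Implicit Types J : {mpoly k[N]} -> Prop.

(* Nakayama by the determinant trick: if the fiber ideal were the unit ideal, the
   matrix [M] below, which vanishes at [a], would fix the generators modulo [J]. *)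
Lemma fiber_ideal_proper J d (f : 'I_d -> {mpoly k[N]}) (a : 'I_d -> k) :
  is_ideal J -> finite_over J f (fun i : 'I_N => 'X_i) ->
  (forall P, J (msub f P) -> P.@[a] = 0) ->
  ~ exists r : 'I_d -> {mpoly k[N]}, J (1 - \sum_i r i * (f i - (a i)%:MP)).
Proof.
move=> idJ [I0 [B0 allB0]] closure_a [r Jr].
pose q := #|I0|; pose B (l : 'I_q) := B0 (enum_val l).
have allB p : modspan J f B p.
  apply: (modspan_sub (B := B0) idJ) => [i|]; last by rewrite -[p]msub_id.
  by rewrite -(enum_rankK i); apply: (modspan_gen idJ f B).
have [c Jc] := fin_all_exists (fun il : 'I_d * 'I_q => allB (r il.1 * B il.2)).
have [e Je] := allB 1.
pose M : 'M[{mpoly k[d]}]_q :=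
  \matrix_(l, l') \sum_i ('X_i - (a i)%:MP) * c (i, l) l'.
pose D := \det (1%:M - M).
have Da : D.@[a] = 1.
  rewrite -det_map_mx; suff -> : map_mx (meval a) (1%:M - M) = 1%:M by apply: det1.
  apply/matrixP => l l'; rewrite !mxE rmorphB rmorph_nat rmorph_sum big1 ?subr0 //= => i _.
  by rewrite rmorphM rmorphB /= mevalXU mevalC subrr mul0r.
have JMB l : J (\sum_l' map_mx (msub f) (1%:M - M) l l' * B l').
  have -> : \sum_l' map_mx (msub f) (1%:M - M) l l' * B l'
      = (1 - \sum_i r i * (f i - (a i)%:MP)) * B l
        + \sum_i (f i - (a i)%:MP) * (r i * B l - \sum_l' msub f (c (i, l) l') * B l').
    transitivity (B l - \sum_i (f i - (a i)%:MP) * \sum_l' msub f (c (i, l) l') * B l').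
      under eq_bigr do rewrite !mxE rmorphB rmorph_nat mulrBl.
      rewrite sumrB (bigD1 l) //= eqxx mul1r big1 ?addr0; last first.
        by move=> l' /negPf; rewrite eq_sym => ->; rewrite mul0r.
      congr (_ - _).
      under [RHS]eq_bigr do rewrite mulr_sumr.
      rewrite [RHS]exchange_big /=; apply: eq_bigr => l' _.
      rewrite rmorph_sum mulr_suml; apply: eq_bigr => i _.
      by rewrite rmorphM rmorphB /= msubX msubC mulrA.
    under [X in _ = _ + X]eq_bigr do rewrite mulrBr.
    rewrite sumrB mulrBl mul1r -addrA; congr (_ + _).
    rewrite addrA -[LHS]add0r; congr (_ - _); apply/esym.
    rewrite mulr_suml addrC -sumrB big1 // => i _; ring.
  apply: idlD => //; first by apply: idlMr.
  by apply: (idl_sum idJ) => i _; apply: (idlMl idJ); apply: (Jc (i, l)).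
(* Cramer's rule: multiplying the relations [JMB] by the adjugate puts [D(f) * B l] in [J]. *)
have JDB l : J (msub f D * B l).
  have -> : msub f D * B l = \sum_j (\adj (map_mx (msub f) (1%:M - M))) l j *
      \sum_l' map_mx (msub f) (1%:M - M) j l' * B l'.
    under eq_bigr do rewrite mulr_sumr.
    rewrite exchange_big /=.
    under eq_bigr do under eq_bigr do rewrite mulrA.
    under eq_bigr do rewrite -mulr_suml.
    pose M' := map_mx (msub f) (1%:M - M).
    have adjM l' : \sum_j \adj M' l j * M' j l' = msub f D *+ (l == l').
      have /matrixP/(_ l l') := mul_adj_mx M'; rewrite !mxE => ->.
      by rewrite /M' det_map_mx.
    rewrite (bigD1 l) //= adjM eqxx mulr1n big1 ?addr0 // => l' ne_l'.
    by rewrite adjM eq_sym (negPf ne_l') mulr0n mul0r.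
  by apply: idl_sum => // j _; apply: idlMl.
(* Since [1] is a combination of the [B l], [D(f)] itself lies in [J]; the closure hypothesis then
   gives [D(a) = 0], whereas [D(a) = 1]. *)
have JD : J (msub f D).
  apply: (idl_congr idJ (q := msub f D * \sum_l msub f (e l) * B l)).
    by rewrite -[X in X - _]mulr1 -mulrBr; apply: idlMl.
  rewrite mulr_sumr; apply: idl_sum => // l _.
  by rewrite mulrCA; apply: idlMl.
by have := closure_a _ JD; rewrite Da => /eqP; rewrite oner_eq0.
Qed.

(** If every [t - z] were a unit modulo [J], the linear factors of [q] could be cancelled one after
    another, until [J] contained a nonzero constant. *)
Lemma algebraic_specialize J (t : {mpoly k[N]}) (q : {poly k}) :
  is_ideal J -> ~ J 1 -> q != 0 -> J (map_poly (@mpolyC N k) q).[t] ->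
  exists z, ~ exists r, J (1 - r * (t - z%:MP)).
Proof.
move=> idJ nJ1 nz_q Jq; apply: NNPP => nex.
have ex z : exists r, J (1 - r * (t - z%:MP)).
  by apply: NNPP => nz; apply: nex; exists z.
have [n szq] := ubnP (size q); elim: n q szq nz_q Jq => // n IH q szq nz_q Jq.
have [/eqP/size_poly1P[c nz_c def_q]|sz1] := eqVneq (size q) 1%N.
  apply: nJ1; rewrite -mpolyC1 -(mulVf nz_c) mpolyCM; apply: idlMl => //.
  by move: Jq; rewrite def_q map_polyC hornerC.
have [z /factor_theorem[q' def_q]] := closed_k sz1.
have nz_q' : q' != 0 by apply: contra_neq nz_q => q'0; rewrite def_q q'0 mul0r.
apply: (IH q') => //.
  by move: szq; rewrite def_q size_Mmonic ?monicXsubC // size_XsubC addn2.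
have [r Jr] := ex z; move: Jq.
rewrite def_q rmorphM rmorphB /= map_polyX map_polyC hornerM !hornerE.
set u := (map_poly _ q').[t] => Jq.
have -> : u = u * (1 - r * (t - z%:MP)) + r * (u * (t - z%:MP)) by ring.
by apply: idlD => //; apply: idlMl.
Qed.

(** The Nullstellensatz for a quotient of finite dimension over [k]: every element is algebraic
    modulo [J], and the coordinates are given values one at a time while the enlarged ideal stays
    proper. *)
Lemma finite_dim_point J (I : finType) (B : I -> {mpoly k[N]}) :
  is_ideal J -> ~ J 1 ->
  (forall p, exists c : I -> k, J (p - \sum_i (c i)%:MP * B i)) ->
  exists x, forall p, J p -> p.@[x] = 0.
Proof.
move=> idJ nJ1 allB.
(* The first [#|I| + 1] powers of [t] are linearly dependent modulo [J]. *)
have alg t : exists2 q : {poly k}, q != 0 & J (map_poly (@mpolyC N k) q).[t].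
  have [c Jc] := fin_all_exists (fun e : 'I_#|I|.+1 => allB (t ^+ e)).
  have [|v [[e nz_v] kerc]] := @kernel_nonzero k _ _ c; first by rewrite card_ord.
  pose q := \poly_(j < #|I|.+1) v (inord j).
  exists q.
    apply: contra_neq nz_v => q0; have := coef_poly #|I|.+1 (fun j => v (inord j)) e.
    by rewrite -/q q0 coef0 ltn_ord inord_val.
  rewrite /q poly_def rmorph_sum horner_sum /=.
  apply: (idl_congr idJ (q := \sum_(j < #|I|.+1) (v j)%:MP * \sum_i (c j i)%:MP * B i)).
    rewrite -sumrB; apply: idl_sum => // j _.
    rewrite inord_val map_polyZ map_polyXn hornerZ hornerXn -mulrBr.
    by apply: idlMl.
  under eq_bigr do rewrite mulr_sumr.
  rewrite exchange_big /= big1; first by apply: idl0.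
  move=> i _; under eq_bigr do rewrite mulrA -mpolyCM.
  by rewrite -mulr_suml -raddf_sum /= kerc mpolyC0 mul0r.
have [J' [x [[idJ' nJ'1] [JJ' Jx]]]] : exists (J' : {mpoly k[N]} -> Prop) x,
    (is_ideal J' /\ ~ J' 1) /\ (forall p, J p -> J' p) /\
    forall i : 'I_N, J' ('X_i - (x i)%:MP).
  suff /(_ N (leqnn N)) [J' [x [? [? Jx]]]] : forall n, (n <= N)%N ->
      exists (J' : {mpoly k[N]} -> Prop) x,
      (is_ideal J' /\ ~ J' 1) /\ (forall p, J p -> J' p) /\
      forall i : 'I_N, (i < n)%N -> J' ('X_i - (x i)%:MP).
    by exists J', x; split=> //; split=> // i; apply: Jx.
  elim=> [|n IH] le_nN; first by exists J, (fun=> 0).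
  have [J' [x [[idJ' nJ'1] [JJ' Jx]]]] := IH (ltnW le_nN).
  have [q nz_q Jq] := alg 'X_(Ordinal le_nN).
  have [z nz] := algebraic_specialize idJ' nJ'1 nz_q (JJ' _ Jq).
  pose t := 'X_(Ordinal le_nN) - z%:MP : {mpoly k[N]}.
  pose J2 p := exists r : 'I_1 -> {mpoly k[N]}, J' (p - \sum_i r i * t).
  have idJ2 : is_ideal J2 := idl_adjoin idJ' _.
  have J'2 p : J' p -> J2 p.
    by exists (fun=> 0); rewrite big1 ?subr0 // => i _; rewrite mul0r.
  exists J2, (fun i => if i == Ordinal le_nN then z else x i); split; first split.
  - by [].
  - by move=> [r]; rewrite big_ord1 => Jr; apply: nz; exists (r 0).
  - split=> [p /JJ'/J'2 //|i]; rewrite ltnS leq_eqVlt => /orP[/eqP ei|lt_in].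
      have -> : i = Ordinal le_nN by apply: val_inj.
      rewrite eqxx; exists (fun=> 1); rewrite big_ord1 mul1r subrr.
      by apply: idl0.
    rewrite ifN; first exact/J'2/Jx.
    by rewrite -val_eqE /= neq_ltn lt_in.
exists x => p Jp; apply: NNPP => /eqP nz_px; apply: nJ'1.
(* Modulo [J'] a polynomial equals its value at [x], so a nonzero value would be a unit lying in
   [J']. *)
have Jpx : J' (p - (p.@[x])%:MP).
  rewrite {1}(mpolyE p) [p.@[x]]mevalE raddf_sum -sumrB; apply: idl_sum => // m _ /=.
  rewrite mpolyCM -mul_mpolyC -mulrBr; apply: idlMl => //.
  rewrite -mevalX; elim/mnm_ind: m => [|i m Jm].
    by rewrite mpolyX0 meval1 subrr; apply: idl0.
  rewrite mpolyXD mevalM mevalXU mpolyCM.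
  have -> : 'X_i * 'X_[m] - (x i)%:MP * ('X_[m].@[x])%:MP
    = 'X_i * ('X_[m] - ('X_[m].@[x])%:MP) + ('X_[m].@[x])%:MP * ('X_i - (x i)%:MP)
    :> {mpoly k[N]} by ring.
  by apply: idlD => //; apply: idlMl => //; apply: Jx.
rewrite -mpolyC1 -(mulVf nz_px) mpolyCM; apply: idlMl => //.
rewrite -[_%:MP](subKr p); apply: idlB => //; exact: JJ'.
Qed.

(** The third hypothesis places [a] in the closure of the image. Adjoining the [f i - a i] to [J]
    keeps the ideal proper and turns coefficients in [k[f]] into constants, so the quotient has
    finite dimension over [k]. *)
Lemma fiber_nonempty J d (f : 'I_d -> {mpoly k[N]}) (a : 'I_d -> k) :
  is_ideal J -> finite_over J f (fun i : 'I_N => 'X_i) ->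
  (forall P, J (msub f P) -> P.@[a] = 0) ->
  exists x, (forall p, J p -> p.@[x] = 0) /\ forall i, (f i).@[x] = a i.
Proof.
move=> idJ fin_f closure_a.
have nJ1 := fiber_ideal_proper idJ fin_f closure_a.
have [I [B allB]] := fin_f.
pose J1 p := exists r : 'I_d -> {mpoly k[N]}, J (p - \sum_i r i * (f i - (a i)%:MP)).
have idJ1 : is_ideal J1 := idl_adjoin idJ _.
have JJ1 p : J p -> J1 p.
  by exists (fun=> 0); rewrite big1 ?subr0 // => i _; rewrite mul0r.
have J1f i : J1 (f i - (a i)%:MP).
  exists (fun j => (j == i)%:R); rewrite (bigD1 i) //= eqxx mul1r big1 ?addr0 ?subrr.
    by apply: idl0.
  by move=> j /negPf ->; rewrite mul0r.
have J1P P : J1 (msub f P - (P.@[a])%:MP).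
  rewrite /mmap mevalE raddf_sum -sumrB; apply: idl_sum => // m _ /=.
  rewrite mpolyCM -mulrBr; apply: idlMl => //.
  rewrite -mevalX; elim/mnm_ind: m => [|i m Jm].
    by rewrite mmap11 mpolyX0 meval1 subrr; apply: idl0.
  rewrite mmap1S mpolyXD mevalM mevalXU mpolyCM.
  have -> : f i * mmap1 f m - (a i)%:MP * ('X_[m].@[a])%:MP
    = f i * (mmap1 f m - ('X_[m].@[a])%:MP) + ('X_[m].@[a])%:MP * (f i - (a i)%:MP)
    by ring.
  by apply: idlD => //; apply: idlMl.
have [p|x Jx] := finite_dim_point (B := B) idJ1 nJ1.
  have [c Jc] := allB p; rewrite msub_id in Jc; exists (fun i => (c i).@[a]).
  apply: (idl_congr idJ1 (q := \sum_i (msub f (c i) - ((c i).@[a])%:MP) * B i)).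
    rewrite -addrA -opprD -big_split /=.
    under eq_bigr do rewrite -mulrDl addrC subrK.
    exact: JJ1.
  by apply: idl_sum => // i _; apply: idlMr.
exists x; split=> [p /JJ1/Jx //|i].
by have := Jx _ (J1f i); rewrite mevalB mevalC => /eqP; rewrite subr_eq0 => /eqP.
Qed.

End Fiber.

(** * Noether normalization and the Nullstellensatz *)

Section TopCoefficient.
Variables (k : fieldType) (n m : nat).
Variables (w : 'I_n -> {mpoly k[m]}) (c : 'I_n -> k).

Definition line_family (i : 'I_n) : {poly {mpoly k[m]}} := (w i)%:P + (c i)%:MP *: 'X.

Lemma line_monomial u :
  (size (mmap1 line_family u) <= (mdeg u).+1)%N /\
  (mmap1 line_family u)`_(mdeg u) = ('X_[u].@[c])%:MP.
Proof.
elim/mnm_ind: u => [|i u [szu cu]].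
  by rewrite mmap11 mdeg0 size_poly1 coef1 mpolyX0 meval1.
rewrite mmap1S mpolyXD mevalM mevalXU mpolyCM mdegD mdeg1 add1n /line_family mulrDl.
split; last first.
  rewrite coefD coefCM -scalerAl coefZ coefXM /= cu.
  by rewrite nth_default // mulr0 add0r.
apply: leq_trans (size_polyD _ _) _; rewrite geq_max; apply/andP; split.
  by rewrite mul_polyC; apply: leq_trans (size_scale_leq _ _) _; apply: leqW.
rewrite -scalerAl; apply: leq_trans (size_scale_leq _ _) _.
by rewrite -commr_polyX; apply: leq_trans (size_polyMleq _ _) _; rewrite size_polyX addn2.
Qed.

(** Only the monomials of degree [e] reach the power [e] of the parameter, each through its value at
    the direction [c]; hence that coefficient is a constant of [k]. *)
Lemma line_top e P : (msize P <= e.+1)%N ->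
  let Q := mmap (polyC \o @mpolyC m k) line_family P in
  (size Q <= e.+1)%N /\ Q`_e = ((pihomog mdeg e P).@[c])%:MP.
Proof.
move=> szP /=; rewrite /mmap.
have sz_u u : u \in msupp P -> (mdeg u <= e)%N.
  by move=> uP; rewrite -ltnS; apply: leq_trans szP; apply: msize_mdeg_lt.
split.
  rewrite big_seq; elim/big_ind: _ => [|p q szp szq|u uP].
  - by rewrite size_poly0.
  - by apply: leq_trans (size_polyD _ _) _; rewrite geq_max szp.
  rewrite /= mul_polyC; apply: leq_trans (size_scale_leq _ _) _.
  by apply: leq_trans (line_monomial u).1 _; rewrite ltnS sz_u.
rewrite coef_sum pihomogE (raddf_sum (meval c)) (raddf_sum (@mpolyC m k)) /=.
rewrite big_seq [RHS]big_seq_cond.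
rewrite big_mkcond [RHS]big_mkcond; apply: eq_bigr => u _.
case: ifP => //= uP; rewrite coefCM mevalZ mpolyCM.
have [<-|ne_ue] := eqVneq (mdeg u) e; first by rewrite (line_monomial u).2.
rewrite nth_default ?mulr0 //; apply: leq_trans (line_monomial u).1 _.
by rewrite ltn_neqAle ne_ue sz_u.
Qed.

End TopCoefficient.

Lemma rmorph_mmap (k : fieldType) (A B : comNzRingType) n
    (psi : {rmorphism A -> B}) (phi : k -> A) (h : 'I_n -> A) P :
  psi (mmap phi h P) = mmap (psi \o phi) (psi \o h) P.
Proof.
rewrite /mmap rmorph_sum; apply: eq_bigr => m _; rewrite rmorphM /= /mmap1 rmorph_prod.
by congr (_ * _); apply: eq_bigr => i _; rewrite rmorphXn.
Qed.

Section Noether.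
Variables (k : fieldType) (N : nat) (J : {mpoly k[N]} -> Prop).
Hypotheses (closed_k : alg_closed k) (idJ : is_ideal J) (nJ1 : ~ J 1).

Lemma finite_over_refl d (f : 'I_d -> {mpoly k[N]}) : finite_over J f f.
Proof.
exists unit, (fun=> 1) => P; rewrite -[msub f P]mulr1.
by apply: modspanM => //; apply: (modspan_gen idJ f (fun=> 1) tt).
Qed.

(* A linear change of variables makes a relation [P] monic in the last one. *)
Lemma dependent_step n (g : 'I_n.+1 -> {mpoly k[N]}) P :
  P != 0 -> J (msub g P) ->
  exists g' : 'I_n -> {mpoly k[N]}, finite_over J g' g.
Proof.
move=> nz_P JP; pose e := (msize P).-1.
have szP : msize P = e.+1 by rewrite /e -mpolySpred.
have nz_top : pihomog mdeg e P != 0.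
  apply/negP => /eqP top0; have := nz_P; rewrite -mleadc_eq0 => /negP[].
  have := congr1 (mcoeff (mlead P)) top0; rewrite mcoeff0 => <-.
  rewrite pihomogE big_mkcond raddf_sum (bigD1_seq (mlead P)) ?msupp_uniq ?mlead_supp //=.
  rewrite -eqSS mlead_deg // szP eqxx mcoeffZ mcoeffX eqxx mulr1 big1 ?addr0 // => u ne_u.
  by case: ifP; rewrite ?mcoeff0 // mcoeffZ mcoeffX (negPf ne_u) mulr0.
(* The extra factor makes [c ord_max] nonzero as well, so that the last member of [g] can be traded
   for the parameter [T]. *)
have [c] : exists c, (pihomog mdeg e P * 'X_ord_max).@[c] != 0.
  apply: mpoly_nonroot => //; rewrite mulf_neq0 //.
  by rewrite -msize_poly_eq0 msizeX.
rewrite mevalM mevalXU mulf_eq0 negb_or => /andP[nz_c nz_cmax].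
pose T := ((c ord_max)^-1)%:MP * g ord_max.
pose g' j := g (lift ord_max j) - (c (lift ord_max j))%:MP * T.
pose w (i : 'I_n.+1) : {mpoly k[n]} := if unlift ord_max i is Some j then 'X_j else 0.
have gE i : g i = msub g' (w i) + (c i)%:MP * T.
  rewrite /w; case: unliftP => [j|] ->; first by rewrite msubX /g' subrK.
  by rewrite rmorph0 add0r /T mulrA -mpolyCM mulfV // mpolyC1 mul1r.
have [szQ topQ] := line_top w c (eq_leq szP).
set Q := mmap _ _ P in szQ topQ; set u := _.@[c] in topQ nz_c.
have JQ : J (\sum_(j < e.+1) msub g' Q`_j * T ^+ j).
  suff -> : \sum_(j < e.+1) msub g' Q`_j * T ^+ j = msub g P by [].
  transitivity (map_poly (msub g') Q).[T].
    rewrite (horner_coef_wide (n := e.+1)) => [|]; last first.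
      exact: leq_trans (size_poly _ _) szQ.
    by apply: eq_bigr => j _; rewrite coef_map.
  rewrite -[LHS]/(horner_eval T (map_poly (msub g') Q)) /Q.
  rewrite !rmorph_mmap /mmap; apply: eq_bigr => v _ /=.
  rewrite map_polyC /= /horner_eval hornerC msubC; congr (_ * _).
  apply: mmap1_eq => i /=; rewrite rmorphD /= map_polyC map_polyZ map_polyX /=.
  by rewrite /horner_eval hornerD hornerC hornerZ hornerX msubC -gE.
(* The coefficient [u] of [T ^+ e] is a nonzero constant, so the relation expresses [T ^+ e] through
   the lower powers. *)
have spanT (j : 'I_e.+1) : modspan J g' (fun j : 'I_e => T ^+ j) (T ^+ j).
  have [lt_je|ge_je] := ltnP j e.
    exact: (modspan_gen idJ g' (fun j : 'I_e => T ^+ j) (Ordinal lt_je)).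
  have -> : j = ord_max by apply: val_inj; apply/eqP; rewrite eqn_leq ge_je -ltnS ltn_ord.
  exists (fun j : 'I_e => - (u^-1)%:MP * Q`_j).
  have := idlMl idJ (u^-1)%:MP JQ; rewrite big_ord_recr /= topQ msubC mulrDr.
  rewrite [_%:MP * (_ * _)]mulrA -mpolyCM mulVf // mpolyC1 mul1r addrC mulr_sumr.
  rewrite -sumrN; congr (J (_ + _)); apply: eq_bigr => i _.
  by rewrite rmorphM rmorphN /= msubC !mulNr opprK mulrA.
exists g', 'I_e, (fun j : 'I_e => T ^+ j).
apply: (modspan_subalgebra idJ) => [|i j]; first exact: (spanT ord0).
rewrite gE mulrDl; apply: modspanD => //.
  by apply: modspanM => //; apply: (modspan_gen idJ g' (fun j : 'I_e => T ^+ j)).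
rewrite -mulrA -exprS; apply: modspanZ => //.
exact: (spanT (lift ord0 j)).
Qed.

(** A dependent family is replaced by a shorter one over which it is finite, until an independent
    family remains; properness of [J] settles the empty family. *)
Lemma noether_normalization_family n (g : 'I_n -> {mpoly k[N]}) :
  exists d (f : 'I_d -> {mpoly k[N]}), alg_indep J f /\ finite_over J f g.
Proof.
elim: n g => [|n IH] g.
  exists 0, g; split; last exact: finite_over_refl.
  move=> P JP; apply/eqP/negPn/negP => nz_P; apply: nJ1.
  rewrite (nvar0_mpolyC P) msubC in JP.
  have nz_c : P@_0%MM != 0.
    by apply: contra_neq nz_P => P0; rewrite (nvar0_mpolyC P) P0 mpolyC0.
  by rewrite -mpolyC1 -(mulVf nz_c) mpolyCM; apply: idlMl.
case: (classic (alg_indep J g)) => [ind_g|].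
  by exists n.+1, g; split=> //; apply: finite_over_refl.
move=> nind; have [P nP] := not_all_ex_not _ _ nind.
have [JP /eqP nz_P] := imply_to_and _ _ nP.
have [g' fin_g] := dependent_step nz_P JP.
have [d [f [ind_f fin_f]]] := IH g'.
by exists d, f; split=> //; apply: finite_over_trans fin_g.
Qed.

Lemma noether_normalization :
  exists d (f : 'I_d -> {mpoly k[N]}),
    alg_indep J f /\ finite_over J f (fun i : 'I_N => 'X_i).
Proof. exact: noether_normalization_family. Qed.

(** A normalization is algebraically independent, so the origin lies in the closure of its image and
    has a point above it. *)
Lemma weak_nullstellensatz : exists x, forall p, J p -> p.@[x] = 0.
Proof.
have [d [f [ind_f fin_f]]] := noether_normalization.
have [P /ind_f -> |x [Jx _]] := fiber_nonempty closed_k (a := fun=> 0) idJ fin_f.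
  exact: meval0.
by exists x.
Qed.

End Noether.

(** * Noetherianity and chains *)

(** Each tail of [u] attains a minimum; such minima, each taken beyond the previous one, form the
    subsequence. *)
Lemma nondecreasing_subsequence (u : nat -> nat) :
  exists phi : nat -> nat, {homo phi : i j / (i < j)%N} /\
    {homo u \o phi : i j / (i <= j)%N}.
Proof.
have tail_min s : exists j, (s <= j)%N /\ forall l, (s <= l)%N -> (u j <= u l)%N.
  suff tm n j : (s <= j)%N -> (u j < n)%N ->
      exists j, (s <= j)%N /\ forall l, (s <= l)%N -> (u j <= u l)%N.
    exact: (tm (u s).+1 s).
  elim: n j => // n IH j sj uj.
  have [[l [sl ul]]|nex] := classic (exists l, (s <= l)%N /\ (u l < u j)%N).
    by apply: (IH l) => //; apply: leq_trans ul _; rewrite -ltnS.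
  exists j; split=> // l sl; rewrite leqNgt; apply/negP => ul.
  by apply: nex; exists l.
have [nxt nxtP] : exists nxt, forall s, (s <= nxt s)%N /\
    forall l, (s <= l)%N -> (u (nxt s) <= u l)%N.
  exists (fun s => proj1_sig (constructive_indefinite_description _ (tail_min s))) => s.
  by case: constructive_indefinite_description.
pose phi := fix phi i := if i is j.+1 then nxt (phi j).+1 else nxt 0.
have phi_lt : {homo phi : i j / (i < j)%N}.
  by apply: homo_ltn => [? ? ?|i]; [apply: ltn_trans | apply: (nxtP _).1].
exists phi; split=> //; apply: homo_leq => // [? ? ? |i]; first exact: leq_trans.
rewrite /=; case: i => [|i] /=; apply: (nxtP _).2 => //.
exact: (phi_lt i i.+2).
Qed.

(** A subsequence is refined one coordinate after the other until all exponents are nondecreasing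
    along it. *)
Lemma dickson n (m : nat -> 'X_{1..n}) : exists i j, (i < j)%N /\ (m i <= m j)%MM.
Proof.
suff mono s : exists phi : nat -> nat, {homo phi : i j / (i < j)%N} /\
    forall t : 'I_n, (t < s)%N -> {homo (fun i => m (phi i) t) : i j / (i <= j)%N}.
  have [phi [phi_lt phi_le]] := mono n.
  exists (phi 0), (phi 1); split; first exact: phi_lt.
  by apply/mnm_lepP => t; apply: (phi_le t (ltn_ord t) 0 1).
elim: s => [|s [phi [phi_lt phi_le]]]; first by exists id; split.
have [lt_sn|ge_sn] := ltnP s n; last first.
  exists phi; split=> // t lt_ts; apply: phi_le; exact: leq_trans (ltn_ord t) ge_sn.
have [psi [psi_lt psi_le]] := nondecreasing_subsequence (fun i => m (phi i) (Ordinal lt_sn)).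
exists (phi \o psi); split=> [i j lt_ij|t]; first exact/phi_lt/psi_lt.
rewrite ltnS leq_eqVlt => /orP[/eqP ts i j le_ij|lt_ts i j le_ij].
  have -> : t = Ordinal lt_sn by apply: val_inj.
  exact: (psi_le i j le_ij).
apply: (phi_le t lt_ts); have := le_ij; rewrite leq_eqVlt => /orP[/eqP -> //|lt_ij].
exact/ltnW/psi_lt.
Qed.

Section Noetherian.
Variables (k : fieldType) (n : nat).
Implicit Types (S Z : aset k n) (p q : {mpoly k[n]}).

Definition vanishing S p : Prop := forall x, S x -> p.@[x] = 0.

Lemma vanishing_ideal S : is_ideal (vanishing S).
Proof.
split=> [x _|p q Sp Sq x Sx|r p Sp x Sx]; first exact: meval0.
  by rewrite mevalD Sp // Sq // addr0.
by rewrite mevalM Sp // mulr0.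
Qed.

Lemma vanishing_sub S Z : (forall x, Z x -> S x) ->
  forall p, vanishing S p -> vanishing Z p.
Proof. by move=> ZS p Sp x /ZS/Sp. Qed.

Lemma zclosed_zero p : zclosed (fun x : point k n => p.@[x] = 0).
Proof. by move=> x; apply. Qed.

Lemma zclosedI S Z : zclosed S -> zclosed Z -> zclosed (fun x => S x /\ Z x).
Proof.
by move=> cS cZ x clx; split; [apply: cS | apply: cZ] => p vp; apply: clx => y [] *; apply: vp.
Qed.

(* Take [p] with minimal leading monomial among the polynomials vanishing on [Z] but
   not on [S]. *)
Lemma reduced_vanishing S Z :
  zclosed Z -> (forall x, Z x -> S x) -> (exists x, S x /\ ~ Z x) ->
  exists p, [/\ vanishing Z p, p != 0 &
    forall q, vanishing S q -> q != 0 -> ~~ (mlead q <= mlead p)%MM].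
Proof.
move=> cZ ZS [x [Sx nZx]].
have [p [Zp nSp]] : exists p, vanishing Z p /\ ~ vanishing S p.
  apply: NNPP => nex; apply/nZx/cZ => p Zp; apply: NNPP => px.
  by apply: nex; exists p; split=> // /(_ x Sx).
have [m def_m] : exists m, mlead p = m by exists (mlead p).
elim/(well_founded_ind (@ltom_wf n)): m p def_m Zp nSp => m IH p def_m Zp nSp.
case: (classic (exists q, [/\ vanishing S q, q != 0 & (mlead q <= mlead p)%MM])); last first.
  move=> nex; exists p; split=> // [|q Sq nz_q].
    by apply/eqP => p0; apply: nSp => y _; rewrite p0 meval0.
  by apply/negP => le_qp; apply: nex; exists q.
move=> [q [Sq nz_q le_qp]].
(* One division step: a multiple of [q] cancels the leading term of [p]. The remainder [p'] has a
   smaller leading monomial and still vanishes on [Z] but not on [S]. *)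
pose a := (mlead p - mlead q)%MM; pose c := mleadc p / mleadc q.
pose p' := p - c *: (q * 'X_[a]).
have Sq' : vanishing S (c *: (q * 'X_[a])).
  by move=> y Sy; rewrite mevalZ mevalM Sq // mul0r mulr0.
have nSp' : ~ vanishing S p'.
  move=> Sp'; apply: nSp; rewrite -(subrK (c *: (q * 'X_[a])) p).
  exact: (idlD (vanishing_ideal S)).
apply: (IH (mlead p') _ p') => //; last first.
  exact: (idlB (vanishing_ideal Z) Zp (vanishing_sub ZS Sq')).
rewrite -def_m.
have p'0 : p'@_(mlead p) = 0.
  rewrite mcoeffB mcoeffZ -{2}(submK le_qp) -/a mcoeffMX /c.
  by rewrite divfK ?subrr // mleadc_eq0.
rewrite lt_neqAle; apply/andP; split.
  apply/eqP => eq_lead; apply: nSp' => y _.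
  by move/eqP: p'0; rewrite -eq_lead mleadc_eq0 => /eqP ->; rewrite meval0.
apply: le_trans (mleadB_le _ _) _; rewrite leUx lexx /=.
apply: le_trans (mleadZ_le _ _) _; apply: le_trans (mleadM_le _ _) _.
by rewrite mleadXm addmC submK.
Qed.

(** Noetherianity: without a minimal set, an endless strict descent would yield, by
    [reduced_vanishing], leading monomials none of which divides a later one, against [dickson]. *)
Lemma zclosed_minimal (Phi : aset k n -> Prop) :
  (exists Z, zclosed Z /\ Phi Z) ->
  exists Z, [/\ zclosed Z, Phi Z & forall Z', zclosed Z' -> Phi Z' ->
    (forall x, Z' x -> Z x) -> forall x, Z x -> Z' x].
Proof.
move=> [Z0 good0]; apply: NNPP => nmin.
pose good Z := zclosed Z /\ Phi Z.
have smaller (Z : {Z | good Z}) : exists Z' : {Z | good Z},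
    (forall x, proj1_sig Z' x -> proj1_sig Z x) /\
    exists x, proj1_sig Z x /\ ~ proj1_sig Z' x.
  case: Z => Z [cZ PZ] /=; apply: NNPP => nex; apply: nmin; exists Z.
  split=> // Z' cZ' PZ' Z'Z x Zx; apply: NNPP => nZ'x; apply: nex.
  by exists (exist _ Z' (conj cZ' PZ')); split=> //; exists x.
pose nxt (Z : {Z | good Z}) := proj1_sig (constructive_indefinite_description _ (smaller Z)).
have nxtP (Z : {Z | good Z}) : (forall x, proj1_sig (nxt Z) x -> proj1_sig Z x) /\
    exists x, proj1_sig Z x /\ ~ proj1_sig (nxt Z) x.
  by rewrite /nxt; case: constructive_indefinite_description.
pose Zs i : aset k n := proj1_sig (iter i nxt (exist _ Z0 good0)).
have Zs_sub i j : (i <= j)%N -> forall x, Zs j x -> Zs i x.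
  elim: j => [|j IH]; first by rewrite leqn0 => /eqP ->.
  rewrite leq_eqVlt => /orP[/eqP -> //|lt_ij] x Zx.
  by apply: IH => //; apply: (nxtP _).1.
have red i : exists p, [/\ vanishing (Zs i.+1) p, p != 0 &
    forall q, vanishing (Zs i) q -> q != 0 -> ~~ (mlead q <= mlead p)%MM].
  apply: reduced_vanishing; [|exact: (nxtP _).1|exact: (nxtP _).2].
  exact: (proj2_sig (iter i.+1 nxt (exist _ Z0 good0))).1.
pose ps i := proj1_sig (constructive_indefinite_description _ (red i)).
have psP i : [/\ vanishing (Zs i.+1) (ps i), ps i != 0 &
    forall q, vanishing (Zs i) q -> q != 0 -> ~~ (mlead q <= mlead (ps i))%MM].
  by rewrite /ps; case: constructive_indefinite_description.
have [i [j [lt_ij]]] := dickson (fun i => mlead (ps i)).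
have [Zi nz_i _] := psP i; have [_ _ /(_ (ps i)) red_j] := psP j.
by apply/negP/red_j => //; apply: vanishing_sub Zi; apply: Zs_sub.
Qed.

End Noetherian.

(** * Chains of irreducible closed sets and Krull dimension *)

Section Chains.
Variables (k : fieldType) (n : nat).
Hypothesis closed_k : alg_closed k.
Implicit Types (S Z W : aset k n).

Lemma finite_over_vanishing S Z d (f : 'I_d -> {mpoly k[n]}) m (g : 'I_m -> {mpoly k[n]}) :
  (forall x, Z x -> S x) ->
  finite_over (vanishing S) f g -> finite_over (vanishing Z) f g.
Proof.
move=> ZS [I [B fB]]; exists I, B => P; have [c Sc] := fB P.
by exists c; apply: vanishing_sub Sc.
Qed.

Section FiniteMap.
Variables (S : aset k n) (d : nat) (f : 'I_d -> {mpoly k[n]}).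
Hypothesis fin_f : finite_over (vanishing S) f (fun i : 'I_n => 'X_i).

(* [f(Z)] contains the linear subspace spanned by the first [i] basis vectors. *)
Definition covers Z i : Prop := forall a : point k d,
  (forall j : 'I_d, (i <= j)%N -> a j = 0) -> exists x, Z x /\ forall j, (f j).@[x] = a j.

Lemma image_closed Z (a : point k d) : zclosed Z -> (forall x, Z x -> S x) ->
  (forall P, vanishing Z (msub f P) -> P.@[a] = 0) ->
  exists x, Z x /\ forall j, (f j).@[x] = a j.
Proof.
move=> cZ ZS cla; have finZ := finite_over_vanishing ZS fin_f.
have [x [Zx fx]] := fiber_nonempty closed_k (vanishing_ideal Z) finZ cla.
by exists x; split=> //; apply: cZ.
Qed.

(** Images of closed sets are closed, so an image missing a point of the subspace satisfies an
    equation that is nonzero there. If both parts failed, the product of the two equations would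
    vanish on the whole subspace, whose coordinate ring is a domain. *)
Lemma coversU Z A B i : zclosed A -> zclosed B -> zclosed Z ->
  (forall x, Z x -> S x) -> (forall x, Z x -> A x \/ B x) -> covers Z i ->
  covers (fun x => Z x /\ A x) i \/ covers (fun x => Z x /\ B x) i.
Proof.
move=> cA cB cZ ZS ZAB covZ; apply: NNPP => /not_or_and[nA nB].
have witness D : zclosed D -> ~ covers (fun x => Z x /\ D x) i ->
    exists P, vanishing (fun x => Z x /\ D x) (msub f P) /\ exists a : point k d,
      (forall j : 'I_d, (i <= j)%N -> a j = 0) /\ P.@[a] != 0.
  move=> cD nD; apply: NNPP => nex; apply: nD => a La; apply: image_closed.
  - exact: zclosedI.
  - by move=> x [/ZS].
  move=> P vP; apply: NNPP => /eqP Pa; apply: nex.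
  by exists P; split=> //; exists a.
have [P [vP [a [La Pa]]]] := witness A cA nA.
have [Q [vQ [b [Lb Qb]]]] := witness B cB nB.
(* Substituting [t] restricts polynomials to the subspace, by killing the variables of index at
   least [i]. *)
pose t (j : 'I_d) : {mpoly k[d]} := if (j < i)%N then 'X_j else 0.
have evt (D : {mpoly k[d]}) c : (forall j : 'I_d, (i <= j)%N -> c j = 0) ->
    (msub t D).@[c] = D.@[c].
  move=> Lc; rewrite meval_msub; apply: meval_eq => j; rewrite /t.
  by case: ltnP => [_|/Lc ->]; rewrite ?mevalXU ?meval0.
have : msub t (P * Q) = 0.
  apply: mpoly_vanish => // y; rewrite meval_msub; set c : point k d := fun i => _.
  have [|x [Zx fx]] := covZ c; first by move=> j le_ij; rewrite /c /t ltnNge le_ij meval0.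
  have -> : (P * Q).@[c] = (msub f P).@[x] * (msub f Q).@[x].
    by rewrite mevalM !meval_msub; congr (_ * _); apply: meval_eq => j; rewrite fx.
  by case: (ZAB x Zx) => Dx; [rewrite vP ?mul0r | rewrite vQ ?mulr0].
rewrite rmorphM => /eqP; rewrite mulf_eq0 => /orP[] /eqP t0.
  by move: Pa; rewrite -evt // t0 meval0 eqxx.
by move: Qb; rewrite -evt // t0 meval0 eqxx.
Qed.

(** A minimal closed subset that still covers the subspace cannot be split, by [coversU]. *)
Lemma covers_irreducible W i : zclosed W -> (forall x, W x -> S x) -> covers W i ->
  exists Z, [/\ zirreducible Z, covers Z i & forall x, Z x -> W x].
Proof.
move=> cW WS covW.
have [|Z [cZ [ZW covZ] minZ]] :=
  @zclosed_minimal k n (fun Z => (forall x, Z x -> W x) /\ covers Z i).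
  by exists W.
exists Z; split=> //; split=> //; split.
  by have [|x [Zx _]] := covZ (fun=> 0); last by exists x.
move=> A B cA cB ZAB; have [|covD|covD] := coversU cA cB cZ _ ZAB covZ.
- by move=> x /ZW/WS.
- left=> x Zx; suff [] : Z x /\ A x by [].
  by apply: (minZ (fun x => Z x /\ A x)) => //; [apply: zclosedI|split=> // y [/ZW]|move=> y []].
- right=> x Zx; suff [] : Z x /\ B x by [].
  by apply: (minZ (fun x => Z x /\ B x)) => //; [apply: zclosedI|split=> // y [/ZW]|move=> y []].
Qed.

(** The top member is cut by the vanishing of one component of [f]. What remains covers the next
    smaller subspace, and the inclusion is strict because the top member has a point above the basis
    vector that was dropped. *)
Lemma covers_chain i W : (i <= d)%N -> zclosed W -> (forall x, W x -> S x) ->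
  covers W i -> has_chain W i.
Proof.
elim: i W => [|i IH] W le_id cW WS covW;
  have [Z [irrZ covZ ZW]] := covers_irreducible cW WS covW.
  by exists (fun=> Z).
pose o := Ordinal le_id.
pose W' x := Z x /\ (f o).@[x] = 0.
have [|||Zs [Zs_irr Zs_lt]] := IH W' (ltnW le_id).
- by apply: zclosedI; [case: irrZ | apply: zclosed_zero].
- by move=> x [/ZW/WS].
- move=> a La; have [|x [Zx fx]] := covZ a; first by move=> j /ltnW/La.
  by exists x; do !split=> //; rewrite fx La.
exists (fun j => if (j <= i)%N then Zs j else Z); split=> j.
  case: ifP => [le_ji _|_ _]; last by split.
  by have [irr sub] := Zs_irr j le_ji; split=> // x /sub[/ZW].
rewrite ltnS => le_ji /=; rewrite le_ji.
have [lt_ji|ge_ji] := ltnP j i; first exact: Zs_lt.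
have -> : j = i by apply/eqP; rewrite eqn_leq le_ji.
split; first by move=> x /((Zs_irr i (leqnn i)).2 x)[].
have [|x [Zx fx]] := covZ (fun j => (j == o)%:R).
  by move=> l lt_il; rewrite -val_eqE /= gtn_eqF.
exists x; split=> // /((Zs_irr i (leqnn i)).2 x)[_].
by rewrite fx eqxx => /eqP; rewrite oner_eq0.
Qed.

End FiniteMap.

Lemma image_surjective S d (f : 'I_d -> {mpoly k[n]}) : zclosed S ->
  alg_indep (vanishing S) f -> finite_over (vanishing S) f (fun i : 'I_n => 'X_i) ->
  forall a : point k d, exists x, S x /\ forall j, (f j).@[x] = a j.
Proof.
move=> cS ind_f fin_f a; apply: (image_closed fin_f) => // P /ind_f ->.
exact: meval0.
Qed.

Lemma normalization_chain S d (f : 'I_d -> {mpoly k[n]}) : zclosed S ->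
  alg_indep (vanishing S) f -> finite_over (vanishing S) f (fun i : 'I_n => 'X_i) ->
  has_chain S d.
Proof.
move=> cS ind_f fin_f; apply: (covers_chain fin_f) => // a _.
exact: image_surjective ind_f fin_f a.
Qed.

(** On [Z], where [h] vanishes, a relation reduces to its constant coefficient in [h], which is [0]
    by independence. Then [h] is cancelled on the irreducible [Z'], and the degree in [h] drops. *)
Lemma indep_extend Z Z' m (g : 'I_m -> {mpoly k[n]}) h :
  zirreducible Z' -> (forall x, Z x -> Z' x) -> alg_indep (vanishing Z) g ->
  vanishing Z h -> ~ vanishing Z' h ->
  alg_indep (vanishing Z')
    (fun i : 'I_m.+1 => if unlift ord_max i is Some j then g j else h).
Proof.
move=> [cZ' [_ irr]] ZZ' ind_g Zh nZ'h P.
set g' := fun i => _; rewrite mmap_muni.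
have -> : map_poly (msub (g' \o widen_ord (leqnSn m))) (muni P) = map_poly (msub g) (muni P).
  apply: eq_map_poly => r; rewrite /mmap; apply: eq_bigr => u _; congr (_ * _).
  apply: mmap1_eq => i; rewrite /= /g'.
  have -> : widen_ord (leqnSn m) i = lift ord_max i by apply: val_inj; rewrite [RHS]lift_max.
  by rewrite liftK.
have -> : g' ord_max = h by rewrite /g' unlift_none.
move=> vP; apply: muni_eq0; move: vP; move: (muni P) => Q {P g'}.
elim/poly_ind: Q => // Q c IH.
rewrite rmorphD rmorphM /= map_polyX map_polyC hornerD hornerM hornerX hornerC => vQ.
have c0 : c = 0.
  apply: ind_g => x Zx; have := vQ x (ZZ' x Zx).
  by rewrite mevalD mevalM Zh // mulr0 add0r.
rewrite c0 raddf0 addr0 in vQ.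
suff -> : Q = 0 by rewrite c0 mul0r polyC0 addr0.
apply: IH; pose q := (map_poly (msub g) Q).[h].
case: (irr _ _ (@zclosed_zero _ _ h) (@zclosed_zero _ _ q)) => //.
move=> x /vQ; rewrite mevalM => /eqP; rewrite mulf_eq0 => /orP[] /eqP ->; by [right|left].
Qed.

(** Each strict inclusion supplies one more function, vanishing on the smaller set but not on the
    larger one. *)
Lemma chain_alg_indep S m : has_chain S m ->
  exists g : 'I_m -> {mpoly k[n]}, alg_indep (vanishing S) g.
Proof.
move=> [Z [irrZ ltZ]].
suff [g ind_g] : exists g : 'I_m -> {mpoly k[n]}, alg_indep (vanishing (Z m)) g.
  by exists g => P SP; apply: ind_g; apply: vanishing_sub SP; apply: (irrZ m _).2.
suff : forall i, (i <= m)%N ->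
  exists g : 'I_i -> {mpoly k[n]}, alg_indep (vanishing (Z i)) g by apply.
elim=> [|i IH] le_im.
  exists (fun=> 0) => P; rewrite (nvar0_mpolyC P) msubC => vP.
  have [[_ [[x Zx] _]] _] := irrZ 0 le_im.
  by have := vP x Zx; rewrite mevalC => ->; rewrite mpolyC0.
have [g ind_g] := IH (ltnW le_im); have [sub [x [Zx nZx]]] := ltZ i le_im.
have [h [Zh nZh]] : exists h, vanishing (Z i) h /\ ~ vanishing (Z i.+1) h.
  apply: NNPP => nex; apply: nZx; apply: (irrZ i (ltnW le_im)).1.1 => p vp.
  by apply: NNPP => px; apply: nex; exists p; split=> // /(_ x Zx).
exists (fun j : 'I_i.+1 => if unlift ord_max j is Some l then g l else h).
by apply: indep_extend ind_g Zh nZh => //; case: (irrZ i.+1 le_im).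
Qed.

(** Lifting a flag gives the lower bound and counting monomials the upper one; the maximum therefore
    exists, and the [epsilon] in [zdim] selects it. *)
Lemma zdim_normalization S d (f : 'I_d -> {mpoly k[n]}) : zclosed S ->
  alg_indep (vanishing S) f -> finite_over (vanishing S) f (fun i : 'I_n => 'X_i) ->
  zdim S = d.
Proof.
move=> cS ind_f fin_f.
have chain_d := normalization_chain cS ind_f fin_f.
have max_d m : has_chain S m -> (m <= d)%N.
  move=> /chain_alg_indep[g ind_g].
  exact (alg_indep_card_le (vanishing_ideal S) fin_f ind_g).
have ex : exists d, has_chain S d /\ forall m, has_chain S m -> (m <= d)%N by exists d.
have [chain_z max_z] := epsilon_spec (inhabits 0%N) _ ex.
by apply/eqP; rewrite eqn_leq max_d // max_z.
Qed.

End Chains.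

(** * Finiteness of the addition map *)

Lemma dhomog_meval_scale (k : fieldType) n d (F : {mpoly k[n]}) c v :
  F \is d.-homog -> F.@[fun i => c * v i] = c ^+ d * F.@[v].
Proof.
move=> /dhomogP homF; rewrite !mevalE mulr_sumr big_seq [RHS]big_seq.
apply: eq_bigr => m /homF degm; rewrite mulrCA; congr (_ * _).
rewrite -{}degm /= mdegE -prodrXr -big_split /=.
by apply: eq_bigr => i _; rewrite exprMn.
Qed.

Lemma msub_eq (k : fieldType) d N (f g : 'I_d -> {mpoly k[N]}) P :
  f =1 g -> msub f P = msub g P.
Proof. by move=> fg; apply: eq_bigr => m _; rewrite (mmap1_eq _ fg). Qed.

Section LeadingForms.
Variables (k : fieldType) (n : nat) (X Y : aset k n).
Hypotheses (closed_k : alg_closed k) (disjXY : disjoint_at_infinity X Y).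

Definition cone_form (S : aset k n) d (F : {mpoly k[n.+1]}) : Prop :=
  F \is d.-homog /\ forall x, S x -> F.@[homog_pt x] = 0.

Lemma cone_form0 S d : cone_form S d 0.
Proof. by split=> [|x _]; rewrite ?dhomog0 ?meval0. Qed.

Lemma cone_formD S d F G : cone_form S d F -> cone_form S d G -> cone_form S d (F + G).
Proof.
move=> [homF SF] [homG SG]; split=> [|x Sx]; first exact: dhomogD.
by rewrite mevalD SF // SG // addr0.
Qed.

Lemma cone_formM S d e F G : F \is d.-homog -> cone_form S e G -> cone_form S (d + e) (F * G).
Proof.
move=> homF [homG SG]; split=> [|x Sx]; first exact: dhomogM.
by rewrite mevalM SG // mulr0.
Qed.

(** The sum of the homogeneous ideals of the two projective closures. Each step adds a pair of forms
    of equal degree, one for [X] and one for [Y], either of which may be [0]. *)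
Inductive cone_ideal : {mpoly k[n.+1]} -> Prop :=
| ConeIdeal0 : cone_ideal 0
| ConeIdealD d F1 F2 G : cone_form X d F1 -> cone_form Y d F2 -> cone_ideal G ->
    cone_ideal (F1 + F2 + G).

Lemma cone_ideal_ideal : is_ideal cone_ideal.
Proof.
have addJ F G : cone_ideal F -> cone_ideal G -> cone_ideal (F + G).
  move=> JF JG; elim: JF => [|d F1 F2 F' XF1 YF2 _ IH]; first by rewrite add0r.
  by rewrite -addrA; apply: ConeIdealD XF1 YF2 IH.
split=> //; first exact: ConeIdeal0.
move=> r F JF; rewrite (mpolyE r) mulr_suml.
elim/big_ind: _ => //; first exact: ConeIdeal0.
move=> m _; rewrite -mul_mpolyC.
elim: JF => [|d F1 F2 F' XF1 YF2 _ IH]; first by rewrite mulr0; apply: ConeIdeal0.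
have homM : (r@_m)%:MP * 'X_[m] \is (mdeg m).-homog.
  by rewrite mul_mpolyC; apply: dhomogZ; rewrite dhomogX.
by rewrite !mulrDr; apply: ConeIdealD (cone_formM homM XF1) (cone_formM homM YF2) IH.
Qed.

(** Where the chosen coordinate is [1], multiplying by its powers does not alter values and brings
    all summands to a common degree; [E] bounds the degrees present. *)
Lemma cone_ideal_homogenize (i : 'I_n) G : cone_ideal G ->
  exists E, forall e, (E <= e)%N -> exists F1 F2, cone_form X e F1 /\ cone_form Y e F2 /\
    forall v, v (lift ord0 i) = 1 -> G.@[v] = F1.@[v] + F2.@[v].
Proof.
elim=> [|d F1 F2 F' XF1 YF2 _ [E IH]].
  exists 0 => e _; exists 0, 0; do !split; rewrite ?dhomog0 //;
    by move=> x *; rewrite ?meval0 ?addr0.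
exists (maxn d E) => e; rewrite geq_max => /andP[de Ee].
have [G1 [G2 [XG1 [YG2 G12]]]] := IH e Ee.
have homX : ('X_(lift ord0 i) ^+ (e - d) : {mpoly k[n.+1]}) \is (e - d).-homog.
  by rewrite mpolyXn dhomogX /= mdegMn mdeg1 mul1n.
exists ('X_(lift ord0 i) ^+ (e - d) * F1 + G1), ('X_(lift ord0 i) ^+ (e - d) * F2 + G2).
have XF := cone_formM homX XF1; have YF := cone_formM homX YF2.
rewrite subnK // in XF YF; split; first exact: cone_formD.
split; first exact: cone_formD.
move=> v vi; rewrite !mevalD !mevalM !rmorphXn /= mevalXU vi expr1n !mul1r G12 //.
by rewrite addrACA.
Qed.

(* Points at infinity of both closures are excluded in the chart [x_i = 1]; the
   Nullstellensatz there and homogenization make [x_i ^ e] a sum of two leading forms. *)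
Lemma leading_power (i : 'I_n) : exists e F1 F2, cone_form X e F1 /\ cone_form Y e F2 /\
  forall v, v ord0 = 0 -> F1.@[v] + F2.@[v] = v (lift ord0 i) ^+ e.
Proof.
pose l := lift ord0 i.
pose g (b : bool) : {mpoly k[n.+1]} := if b then 'X_ord0 else 'X_l - 1.
pose J p := exists r : bool -> {mpoly k[n.+1]}, cone_ideal (p - \sum_b r b * g b).
have idJ : is_ideal J := idl_adjoin cone_ideal_ideal g.
have coneJ p : cone_ideal p -> J p.
  by exists (fun=> 0); rewrite big1 ?subr0 // => b _; rewrite mul0r.
have Jg b : J (g b).
  exists (fun b' => (b' == b)%:R); rewrite (bigD1 b) //= eqxx mul1r big1 ?addr0 ?subrr.
    exact: ConeIdeal0.
  by move=> b' /negPf ->; rewrite mul0r.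
have [r Jr] : J 1.
  apply: NNPP => nJ1; have [v Jv] := weak_nullstellensatz closed_k idJ nJ1.
  apply: disjXY; exists v; split; first by have := Jv _ (Jg true); rewrite mevalXU.
  split.
    exists l; have := Jv _ (Jg false); rewrite mevalB mevalXU meval1 => /eqP.
    by rewrite subr_eq0 => /eqP ->; apply: oner_neq0.
  split=> d F homF SF; apply/Jv/coneJ.
    rewrite -[F]addr0 -[F in F + _]addr0.
    exact: ConeIdealD (conj homF SF) (cone_form0 _ _) ConeIdeal0.
  rewrite -[F]addr0 -[F in F + _]add0r.
  exact: ConeIdealD (cone_form0 _ _) (conj homF SF) ConeIdeal0.
have [E /(_ E (leqnn E)) [F1 [F2 [XF1 [YF2 F12]]]]] := cone_ideal_homogenize i Jr.
exists E, F1, F2; split=> //; split=> // v v0.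
(* By homogeneity the identity in the chart extends to every vector at infinity whose coordinate [l]
   is nonzero. *)
have chart u : u ord0 = 0 -> u l != 0 -> F1.@[u] + F2.@[u] = u l ^+ E.
  move=> u0 ul; pose w j := (u l)^-1 * u j.
  have wl : w l = 1 by rewrite /w mulVf.
  have : F1.@[w] + F2.@[w] = 1.
    rewrite -F12 // mevalB meval1 rmorph_sum big_bool /= !mevalM mevalB !mevalXU meval1.
    by rewrite wl /w u0 mulr0 mulr0 subrr mulr0 addr0 subr0.
  rewrite !(dhomog_meval_scale _ _ XF1.1) !(dhomog_meval_scale _ _ YF2.1) -mulrDr => eq1.
  by rewrite -[LHS](mulKf (expf_neq0 E (invr_neq0 ul))) eq1 mulr1 exprVn invrK.
pose t (j : 'I_n.+1) : {mpoly k[n.+1]} := if j == ord0 then 0 else 'X_j.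
pose D := F1 + F2 - 'X_l ^+ E.
(* The factor ['X_l] absorbs the vectors whose coordinate [l] is [0]; as a nonzero polynomial it is
   cancelled afterwards. *)
have : msub t D * 'X_l = 0.
  apply: mpoly_vanish => // u; rewrite mevalM mevalXU meval_msub.
  have [->|ul] := eqVneq (u l) 0; first by rewrite mulr0.
  set u' := fun j => _; have u'0 : u' ord0 = 0 by rewrite /u' /t eqxx meval0.
  have u'l : u' l = u l by rewrite /u' [t l]/= mevalXU.
  rewrite mevalB mevalD chart ?u'l // rmorphXn /= mevalXU u'l subrr mul0r //.
move/eqP; rewrite mulf_eq0 => /orP[/eqP tD|]; last first.
  by rewrite -msize_poly_eq0 msizeX.
have := congr1 (meval v) tD; rewrite meval_msub meval0.
rewrite (meval_eq (v2 := v)) => [|j]; last first.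
  by rewrite /t; case: eqP => [->|_]; rewrite ?meval0 ?v0 ?mevalXU.
by rewrite mevalB mevalD rmorphXn /= mevalXU => /eqP; rewrite subr_eq0 => /eqP.
Qed.

End LeadingForms.

Section Product.
Variables (k : fieldType) (n : nat).
Hypothesis closed_k : alg_closed k.

Definition join (x y : point k n) : point k (n + n) :=
  fun i => match split i with inl j => x j | inr j => y j end.

Lemma join_lshift x y j : join x y (lshift n j) = x j.
Proof. by rewrite /join (unsplitK (inl j)). Qed.

Lemma join_rshift x y j : join x y (rshift n j) = y j.
Proof. by rewrite /join (unsplitK (inr j)). Qed.

Definition xvar (j : 'I_n) : {mpoly k[n + n]} := 'X_(lshift n j).
Definition yvar (j : 'I_n) : {mpoly k[n + n]} := 'X_(rshift n j).
Definition zvar (j : 'I_n) : {mpoly k[n + n]} := xvar j + yvar j.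

Lemma meval_xvar x y P : (msub xvar P).@[join x y] = P.@[x].
Proof. by rewrite meval_msub; apply: meval_eq => j; rewrite mevalXU join_lshift. Qed.

Lemma meval_yvar x y P : (msub yvar P).@[join x y] = P.@[y].
Proof. by rewrite meval_msub; apply: meval_eq => j; rewrite mevalXU join_rshift. Qed.

Lemma meval_zvar x y P : (msub zvar P).@[join x y] = P.@[fun j => x j + y j].
Proof.
rewrite meval_msub; apply: meval_eq => j.
by rewrite mevalD !mevalXU join_lshift join_rshift.
Qed.

Definition zprod (X Y : aset k n) : aset k (n + n) :=
  fun p => exists x y, X x /\ Y y /\ p = join x y.

Section Filtration.
Variable J : {mpoly k[n + n]} -> Prop.
Hypothesis idJ : is_ideal J.

Definition xmon s (u : 'X_{1..n < s}) := mmap1 xvar u.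

(* Polynomials of degree less than [s] in [x] with coefficients in [k[z]], modulo [J]. *)
Local Notation xfilt s := (modspan J zvar (@xmon s)).

Lemma xfilt_mon s u : (mdeg u < s)%N -> xfilt s (mmap1 xvar u).
Proof. by move=> lt_us; apply: (modspan_gen idJ zvar (@xmon s) (BMultinom lt_us)). Qed.

Lemma xfiltW s t p : (s <= t)%N -> xfilt s p -> xfilt t p.
Proof.
move=> le_st; apply: (modspan_sub idJ) => u; apply: xfilt_mon.
exact: leq_trans (bmdeg u) le_st.
Qed.

Lemma xfiltX s j p : xfilt s p -> xfilt s.+1 (xvar j * p).
Proof.
apply: (modspan_subM idJ) => u; rewrite -mmap1S; apply: xfilt_mon.
by rewrite mdegD mdeg1 add1n ltnS bmdeg.
Qed.

Section Perturbation.
Variables (h0 h : 'I_n.+1 -> {mpoly k[n + n]}) (w : 'I_n.+1 -> {mpoly k[n]}).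
Hypothesis h0P : forall i, h0 i = if unlift ord0 i is Some j then xvar j else 0.
Hypothesis hP : forall i, h i = h0 i + msub zvar (w i).

Let xfilt_h0 s i p : xfilt s p -> xfilt s.+1 (h0 i * p).
Proof.
move=> sp; rewrite h0P; case: unlift => [j|]; first exact: xfiltX.
by rewrite mul0r; apply: modspan0.
Qed.

(** Passing from [h0] to [h] adds to each argument a polynomial in [z], which counts as degree [0]
    in [x]; the part of top degree in [x] is unchanged. *)
Lemma xfilt_perturb_mon u : xfilt (mdeg u).+1 (mmap1 h0 u) /\
  xfilt (mdeg u) (mmap1 h u - mmap1 h0 u).
Proof.
elim/mnm_ind: u => [|i u [IH0 IH]].
  rewrite !mmap11 subrr; split; last exact: modspan0.
  by rewrite -(mmap11 xvar); apply: xfilt_mon; rewrite mdeg0.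
rewrite !mmap1S mdegD mdeg1 add1n; split; first exact: xfilt_h0.
have -> : h i * mmap1 h u - h0 i * mmap1 h0 u
  = h0 i * (mmap1 h u - mmap1 h0 u) + msub zvar (w i) * (mmap1 h u - mmap1 h0 u)
    + msub zvar (w i) * mmap1 h0 u by rewrite hP; ring.
apply: modspanD => //; last by apply: modspanM.
apply: modspanD => //; first exact: xfilt_h0.
by apply: modspanM => //; apply: xfiltW IH.
Qed.

Lemma xfilt_perturb d F : F \is d.-homog -> xfilt d (msub h F - msub h0 F).
Proof.
move=> /dhomogP homF; rewrite /mmap -sumrB big_seq; apply: modspan_sum => // u uF.
rewrite -mulrBr; apply: modspanZ => //.
by rewrite -(homF u uF); apply: (xfilt_perturb_mon u).2.
Qed.

End Perturbation.

(** A monomial in [x] whose degree exceeds the sum of the [e i] has some exponent at least [e i],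
    and rewriting that power lowers its degree. The variables [y] are then handled by
    [y = z - x]. *)
Lemma xfilt_finite (e : 'I_n -> nat) :
  (forall i, xfilt (e i) (xvar i ^+ e i)) ->
  finite_over J zvar (fun i : 'I_(n + n) => 'X_i).
Proof.
move=> integral_x; pose s := (\sum_i e i).+1.
have all_mon u : xfilt s (mmap1 xvar u).
  have [t] := ubnP (mdeg u); elim: t u => // t IH u; rewrite ltnS => le_ut.
  have [lt_us|ge_us] := ltnP (mdeg u) s; first exact: xfilt_mon.
  have [i le_ei] : exists i, (e i <= u i)%N.
    apply: NNPP => nex; move: ge_us; rewrite leqNgt => /negP; apply; rewrite ltnS mdegE.
    by apply: leq_sum => i _; rewrite leqNgt; apply/negP => lt; apply: nex; exists i; apply: ltnW.
  have le_Uu : (U_(i) *+ e i <= u)%MM.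
    apply/mnm_lepP => j; rewrite mulmnE mnm1E; case: eqP => [<-|_] //.
    by rewrite mul1n.
  have mmapD a b : mmap1 xvar (a + b) = mmap1 xvar a * mmap1 xvar b.
    by rewrite commr_mmap1_M // => ? ?; apply: mulrC.
  pose v := (u - U_(i) *+ e i)%MM.
  have def_u : u = (v + U_(i) *+ e i)%MM by rewrite submK.
  have -> : mmap1 xvar u = mmap1 xvar v * xvar i ^+ e i.
    rewrite {1}def_u mmapD; congr (_ * _).
    elim: (e i) => [|f IHf]; first by rewrite mulm0n mmap11 expr0.
    by rewrite mulmS mmap1S IHf exprS.
  apply: (modspan_subM idJ) (integral_x i) => b; rewrite /xmon -mmapD; apply: IH.
  apply: leq_trans le_ut; rewrite [X in (_ < mdeg X)%N]def_u !mdegD mdegMn mdeg1 mul1n.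
  by rewrite ltn_add2l bmdeg.
exists 'X_{1..n < s}, (@xmon s) => P; apply: (modspan_subalgebra idJ) => [|l b].
  by rewrite -(mmap11 xvar).
have xb j : xfilt s (xvar j * xmon b) by rewrite /xmon -mmap1S.
rewrite -(splitK l); case: (split l) => j /=; first exact: xb.
have -> : 'X_(rshift n j) * xmon b = msub zvar 'X_j * xmon b - xvar j * xmon b.
  by rewrite msubX /zvar /yvar; ring.
apply: modspanD => //; last exact: modspanN.
by apply: modspanM => //; apply: modspan_gen.
Qed.

End Filtration.

(** For [F1] and [F2] given by [leading_power], [F1(1, x)] and [F2(-1, x - z)] vanish on the
    product. They differ from [F1(0, x)] and [F2(0, x)] by terms of lower degree in [x], and these
    two add up to a power of [x_i]. *)
Lemma sum_finite X Y : disjoint_at_infinity X Y ->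
  finite_over (vanishing (zprod X Y)) zvar (fun i : 'I_(n + n) => 'X_i).
Proof.
move=> disj; have idJ := vanishing_ideal (zprod X Y).
have [e eP] : exists e : 'I_n -> nat, forall i,
    modspan (vanishing (zprod X Y)) zvar (@xmon (e i)) (xvar i ^+ e i).
  apply: (@fin_all_exists _ _ (fun i e =>
    modspan (vanishing (zprod X Y)) zvar (@xmon e) (xvar i ^+ e))) => i.
  have [e [F1 [F2 [[hom1 X1] [[hom2 Y2] F12]]]]] := leading_power closed_k disj i.
  exists e.
  (* [h0 = (0, x)], [h1 = (1, x)] and [h2 = (-1, x - z) = - (1, y)]. *)
  pose h0 i := if unlift ord0 i is Some j then xvar j else 0.
  pose w1 (i : 'I_n.+1) : {mpoly k[n]} := if unlift ord0 i is Some j then 0 else 1.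
  pose w2 (i : 'I_n.+1) : {mpoly k[n]} := if unlift ord0 i is Some j then - 'X_j else -1.
  pose h1 i := h0 i + msub zvar (w1 i); pose h2 i := h0 i + msub zvar (w2 i).
  have J1 : vanishing (zprod X Y) (msub h1 F1).
    move=> _ [x [y [Xx [Yy ->]]]]; rewrite meval_msub -[RHS](X1 x Xx).
    apply: meval_eq => j; rewrite /h1 /h0 /w1 /homog_pt mevalD meval_zvar.
    by case: unliftP => [l|] _; rewrite ?mevalXU ?join_lshift ?meval0 ?meval1 ?addr0 ?add0r.
  have J2 : vanishing (zprod X Y) (msub h2 F2).
    move=> _ [x [y [Xx [Yy ->]]]]; rewrite meval_msub.
    rewrite -[RHS](mulr0 ((-1) ^+ e)) -(Y2 y Yy) -(dhomog_meval_scale _ _ hom2).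
    apply: meval_eq => j; rewrite /h2 /h0 /w2 /homog_pt mevalD meval_zvar.
    case: unliftP => [l|] _; last by rewrite meval0 add0r mevalN meval1 mulr1.
    by rewrite mevalN !mevalXU join_lshift mulN1r opprD addrA subrr add0r.
  have F0 : msub h0 F1 + msub h0 F2 = xvar i ^+ e.
    apply/eqP; rewrite -subr_eq0; apply/eqP/mpoly_vanish => // u.
    rewrite mevalB mevalD !meval_msub F12 /h0 ?unlift_none ?meval0 //.
    by rewrite liftK rmorphXn /= subrr.
  have fil1 := xfilt_perturb idJ (h0 := h0) (h := h1) (fun=> erefl) (fun=> erefl) hom1.
  have fil2 := xfilt_perturb idJ (h0 := h0) (h := h2) (fun=> erefl) (fun=> erefl) hom2.
  rewrite -F0.
  apply: (modspan_congr idJ (q := - (msub h1 F1 - msub h0 F1) - (msub h2 F2 - msub h0 F2))).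
    have := idlD idJ J1 J2.
    move: (msub h0 F1) (msub h0 F2) (msub h1 F1) (msub h2 F2) => a b c d.
    by have -> : c + d = a + b - (- (c - a) - (d - b)) by ring.
  by apply: modspanD => //; apply: modspanN.
exact: xfilt_finite eP.
Qed.

(** * Two normalizations of the product and their lengths *)

Lemma modspan_coef N (J : {mpoly k[N]} -> Prop) d (f : 'I_d -> {mpoly k[N]})
    e (g : 'I_e -> {mpoly k[N]}) (w : 'I_d -> {mpoly k[e]}) (I : finType)
    (B : I -> {mpoly k[N]}) p :
  (forall i, f i = msub g (w i)) -> modspan J f B p -> modspan J g B p.
Proof.
move=> fw [c Jc]; exists (fun i => msub w (c i)).
by under eq_bigr do rewrite msub_comp -(msub_eq _ fw).
Qed.

(** This carries finiteness from a factor, or from the sum, up to the product by pulling back along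
    [phi]. *)
Lemma modspan_pull N M (S : aset k N) (T : aset k M) (phi : 'I_N -> {mpoly k[M]})
    d (f : 'I_d -> {mpoly k[N]}) (I : finType) (B : I -> {mpoly k[N]}) p :
  (forall q, vanishing S q -> vanishing T (msub phi q)) ->
  modspan (vanishing S) f B p ->
  modspan (vanishing T) (fun i => msub phi (f i)) (fun i => msub phi (B i)) (msub phi p).
Proof.
move=> pull [c Sc]; exists c; have := pull _ Sc.
rewrite rmorphB rmorph_sum /=.
by under eq_bigr do rewrite rmorphM /= msub_comp.
Qed.

Section ProductFamily.
Variables (X Y : aset k n) (dX dY : nat).
Variables (fX : 'I_dX -> {mpoly k[n]}) (fY : 'I_dY -> {mpoly k[n]}).
Hypotheses (cX : zclosed X) (cY : zclosed Y).
Hypotheses (indX : alg_indep (vanishing X) fX) (indY : alg_indep (vanishing Y) fY).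
Hypothesis finX : finite_over (vanishing X) fX (fun i : 'I_n => 'X_i).
Hypothesis finY : finite_over (vanishing Y) fY (fun i : 'I_n => 'X_i).

Definition prod_family (i : 'I_(dX + dY)) : {mpoly k[n + n]} :=
  match split i with inl j => msub xvar (fX j) | inr j => msub yvar (fY j) end.

(** Both normalizations are surjective onto affine space, hence so is their product, and a relation
    vanishes at every point. *)
Lemma prod_family_indep : alg_indep (vanishing (zprod X Y)) prod_family.
Proof.
move=> P vP; apply: mpoly_vanish => // a.
have [x [Xx fx]] := image_surjective closed_k cX indX finX (fun j => a (lshift dY j)).
have [y [Yy fy]] := image_surjective closed_k cY indY finY (fun j => a (rshift dX j)).
have : (msub prod_family P).@[join x y] = 0 by apply: vP; exists x, y.
rewrite meval_msub => <-; apply: meval_eq => i; rewrite /prod_family -{1}(splitK i).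
by case: (split i) => j /=; rewrite ?meval_xvar ?meval_yvar ?fx ?fy.
Qed.

Lemma prod_family_finite :
  finite_over (vanishing (zprod X Y)) prod_family (fun i : 'I_(n + n) => 'X_i).
Proof.
have idJ := vanishing_ideal (zprod X Y).
have [I [B spanB]] := finX; have [K [C spanC]] := finY.
have spanX p : modspan (vanishing (zprod X Y)) prod_family
    (fun i => msub xvar (B i)) (msub xvar p).
  apply: (modspan_coef (f := fun j => msub xvar (fX j)) (w := fun j => 'X_(lshift dY j))).
    by move=> j; rewrite msubX /prod_family (unsplitK (inl j)).
  apply: (modspan_pull (S := X)); last by rewrite -[p]msub_id.
  by move=> q vq _ [x [y [Xx [Yy ->]]]]; rewrite meval_xvar vq.
have spanY p : modspan (vanishing (zprod X Y)) prod_family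
    (fun i => msub yvar (C i)) (msub yvar p).
  apply: (modspan_coef (f := fun j => msub yvar (fY j)) (w := fun j => 'X_(rshift dX j))).
    by move=> j; rewrite msubX /prod_family (unsplitK (inr j)).
  apply: (modspan_pull (S := Y)); last by rewrite -[p]msub_id.
  by move=> q vq _ [x [y [Xx [Yy ->]]]]; rewrite meval_yvar vq.
exists (I * K)%type, (fun ij => msub xvar (B ij.1) * msub yvar (C ij.2)) => P.
apply: (modspan_subalgebra idJ) => [|l [i j] /=].
  rewrite -[1]mulr1 -{1}(rmorph1 (msub xvar)) -(rmorph1 (msub yvar)).
  exact (modspan_pair idJ (spanX _) (spanY _)).
rewrite -(splitK l); case: (split l) => v /=.
  rewrite mulrA -/(xvar v) -(msubX xvar) -rmorphM; exact (modspan_pair idJ (spanX _) (spanY _)).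
rewrite mulrCA -/(yvar v) -(msubX yvar) -rmorphM; exact (modspan_pair idJ (spanX _) (spanY _)).
Qed.

End ProductFamily.

Lemma zclosed_zclosure (S : aset k n) : zclosed (zclosure S).
Proof. by move=> x clx p vp; apply: clx => y; apply. Qed.

Lemma not_vanishing1 (S : aset k n) : (exists x, S x) -> ~ vanishing S 1.
Proof. by move=> [x Sx] /(_ x Sx) /eqP; rewrite meval1 oner_eq0. Qed.

Lemma minkowski_sumP (X Y : aset k n) x y :
  X x -> Y y -> minkowski_sum X Y (fun j => x j + y j).
Proof. by move=> Xx Yy p; apply; exists x, y. Qed.

Lemma zdim_minkowski_sum (X Y : aset k n) :
  zclosed X -> zclosed Y -> (exists x, X x) -> (exists y, Y y) ->
  disjoint_at_infinity X Y ->
  zdim (minkowski_sum X Y) = (zdim X + zdim Y)%N.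
Proof.
move=> cX cY neX neY disj; pose Z := minkowski_sum X Y.
have neZ : exists z, Z z.
  have [x Xx] := neX; have [y Yy] := neY.
  by exists (fun j => x j + y j); apply: minkowski_sumP.
have normalize S : (exists x, S x) -> exists d (f : 'I_d -> {mpoly k[n]}),
    alg_indep (vanishing S) f /\ finite_over (vanishing S) f (fun i : 'I_n => 'X_i).
  move=> neS; apply: noether_normalization => //; first exact: vanishing_ideal.
  exact: not_vanishing1.
have [dX [fX [indX finX]]] := normalize X neX.
have [dY [fY [indY finY]]] := normalize Y neY.
have [e [h [indh finh]]] := normalize Z neZ.
rewrite (zdim_normalization closed_k cX indX finX) (zdim_normalization closed_k cY indY finY).
rewrite (zdim_normalization closed_k (@zclosed_zclosure _) indh finh).
pose W := zprod X Y; have idJ := vanishing_ideal W.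
pose H j := msub zvar (h j).
(* The sums [x + y] are dense in [Z], so a relation holding on the product already holds on [Z]. *)
have indH : alg_indep (vanishing W) H.
  move=> P vP; apply: indh => z; apply => _ [x [y [Xx [Yy ->]]]].
  rewrite -meval_zvar msub_comp; apply: vP; by exists x, y.
have finH : finite_over (vanishing W) H (fun i : 'I_(n + n) => 'X_i).
  apply: (finite_over_trans idJ) (sum_finite disj).
  have [I [B spanB]] := finh; exists I, (fun i => msub zvar (B i)) => P.
  apply: (modspan_pull (S := Z)); last by rewrite -[P]msub_id.
  move=> q vq _ [x [y [Xx [Yy ->]]]]; rewrite meval_zvar; apply: vq.
  exact: minkowski_sumP.
have indF := prod_family_indep cX cY indX indY finX finY.
have finF := prod_family_finite finX finY.
(* Both [H] and [prod_family] are independent and the coordinate ring of the product is finite over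
   each, so each length bounds the other. *)
apply/eqP; rewrite eqn_leq; apply/andP; split.
  exact (alg_indep_card_le idJ finF indH).
exact (alg_indep_card_le idJ finH indF).
Qed.

End Product.

Theorem theorem3p10 (k : closedFieldType) (n : nat) (X Y : aset k n) :
  2%N \notin [pchar k] ->
  zclosed X -> zclosed Y ->
  (exists x, X x) -> (exists y, Y y) ->
  disjoint_at_infinity X Y ->
  zdim (minkowski_sum X Y) = (zdim X + zdim Y)%N.
Proof.
move=> _; apply: zdim_minkowski_sum => p sz_p; exact/closed_rootP.
Qed.
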